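(* (a) Let $n>k\ge 2$. Then \[ \binom{n}{2}-\left\lceil\frac{kn}{2}\right\rceil+1\le mc_k(K_n)\le\binom{n}{2}-\left\lceil\frac{(k-1)n(n-1)}{2(n-2)}\right\rceil+1. \] (b) Let $n>k$, where $k\in\{2,3,4,5\}$. Then \[ mc_k(K_n)=\binom{n}{2}-\left\lceil\frac{kn}{2}\right\rceil+1. \]
   Context: $K_n$ is the complete graph on $n$ vertices. Paths are called disjoint if they are internally vertex-disjoint. An edge-coloured path is monochromatic if all its edges have the same colour. For a $k$-connected graph $G$, an edge-colouring is monochromatic $k$-connected if any two vertices are connected by $k$ disjoint monochromatic paths; $mc_k(G)$ is the maximum number of colours in a monochromatic $k$-connected colouring of $G$. *)

(* Defs.v *)
From mathcomp Require Import all_boot.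
Set Implicit Arguments. Unset Strict Implicit. Unset Printing Implicit Defensive.

(* The complete graph K_n has vertex set 'I_n and every pair of distinct
   vertices is an edge.  An edge-colouring of K_n is a symmetric function
   c : 'I_n -> 'I_n -> nat (colours are natural numbers); the values on the
   diagonal c x x are irrelevant (there are no loops). *)
Definition edge_colouring (n : nat) (c : 'I_n -> 'I_n -> nat) : Prop :=
  forall x y, c x y = c y x.

Definition ncolours (n : nat) (c : 'I_n -> 'I_n -> nat) : nat :=
  size (undup [seq c p.1 p.2 | p <- enum [pred p : 'I_n * 'I_n | p.1 < p.2]]).

(* A path from u to v in K_n is given by its sequence s of internal vertices:
   the vertex sequence is u :: s ++ [:: v], with all vertices distinct.  It is
   monochromatic if all its edges have the same colour. *)
Definition mono_path (n : nat) (c : 'I_n -> 'I_n -> nat) (u v : 'I_n)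
  (s : seq 'I_n) : Prop :=
  uniq (u :: rcons s v) /\
  exists col : nat, path (fun a b => c a b == col) u (rcons s v).

Definition mono_k_connected (n k : nat) (c : 'I_n -> 'I_n -> nat) : Prop :=
  forall u v : 'I_n, u != v ->
    exists ps : seq (seq 'I_n),
      [/\ size ps = k, uniq ps,
          (forall s, s \in ps -> mono_path c u v s) &
          (forall i j, i < j -> j < k ->
             ~~ has (fun x => x \in nth [::] ps j) (nth [::] ps i))].

Definition is_mc_complete (k n m : nat) : Prop :=
  (exists c : 'I_n -> 'I_n -> nat, edge_colouring c /\ mono_k_connected k c /\ ncolours c = m) /\
  (forall c : 'I_n -> 'I_n -> nat, edge_colouring c -> mono_k_connected k c -> ncolours c <= m).

(* Main.v *)
Require Import Defs.
From Stdlib Require Import Classical_Prop.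
From mathcomp Require Import all_boot zify.

(**
Lower bound: give one colour to the edges of a Harary graph, which is k-connected with
at most ceil(kn/2) edges, and a private colour to each other edge.  Menger's theorem
yields k-1 disjoint paths of length at least 2 in the Harary graph, and the edge uv is
the k-th path.

Upper bounds: splitting colours into their components we may assume that every colour
class C is connected, on m_C vertices and with a_C >= 2 (m_C - 1) arcs.  For a pair u, v,
each of the n-2 other vertices w is a possible first step from u and a possible last
step to v; the k-1 long paths use k-1 steps of either kind.  A step is wasted if the
colour of uw does not reach v, and one of the two is wasted if uw and wv have different
colours.  Counting wasted steps over all pairs gives part (a).

For part (b), let d_C(v) be the degree of v in C.  Counting first and last steps by
colour gives sum_C min(d_C(u), d_C(v)) >= k.  Hence every vertex has degree D(v) >= k in
the nontrivial colours, and the claim becomes sum_v D(v) >= kn + 2 (N - 1), with N the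
number of nontrivial colours.  If some v has D(v) = k, looking from v at the degrees of
the other vertices in the colours at v gives the claim when v lies in one colour only or
has degree 1 in one of its colours; otherwise, as k <= 5, v lies in two spanning colours
and has degree 2 in one of them, and disjointness of the paths of the two colours is
contradictory when no other nontrivial colour exists.  If D(v) > k for all v, the count
of wasted steps suffices.
*)

Set Implicit Arguments. Unset Strict Implicit. Unset Printing Implicit Defensive.

(** * Menger's theorem *)

Section Menger.
Variable V : finType.
Implicit Types (E : {set V * V}) (A B S P : {set V}).

Definition erel E : rel V := fun x y => (x, y) \in E.

Definition separates E A B S :=
  forall x s, x \in A -> path (erel E) x s -> last x s \in B -> has [in S] (x :: s).

(** Each path is stored as its first vertex [h i] and the rest [f i]. With [f i] empty it is a
    single vertex of the intersection of [A] and [B]. *)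
Definition linked k E A B :=
  exists (h : 'I_k -> V) (f : 'I_k -> seq V),
    [/\ forall i, h i \in A, forall i, path (erel E) (h i) (f i),
        forall i, last (h i) (f i) \in B, forall i, uniq (h i :: f i)
      & forall i j x, x \in h i :: f i -> x \in h j :: f j -> i = j].

Lemma linked_mono k E E' A B : E' \subset E -> linked k E' A B -> linked k E A B.
Proof.
move=> sE [h [f [hA pf lB uf dj]]]; exists h, f; split=> // i.
by apply: sub_path (pf i) => x y; apply: (subsetP sE).
Qed.

(** A path that uses the arc passes through both of its ends, so adding either end to [S] blocks
    it. *)
Lemma separates_arc E A B S x y :
  separates (E :\ (x, y)) A B S -> separates E A B (x |: S) /\ separates E A B (y |: S).
Proof.
move=> sS.
have key z s : z \in A -> path (erel E) z s -> last z s \in B ->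
    has [in S] (z :: s) \/ (x \in z :: s /\ y \in z :: s).
  move=> zA pz zB.
  have [p|np] := boolP (path (erel (E :\ (x, y))) z s); first by left; apply: (sS).
  right; elim: s z {zA zB} pz np => //= w s IH z /andP [zw pw].
  rewrite negb_and => /orP [|np].
    rewrite /erel !inE negb_and /= => /orP [|]; last by move/negP.
    by rewrite negbK => /eqP [-> ->]; rewrite !eqxx ?orbT.
  have [] := IH _ pw np; rewrite !inE => H1 H2.
  by split; apply/orP; right.
split=> z s zA pz zB; have [H|[Hx Hy]] := key _ _ zA pz zB.
- by apply: sub_has H => w; rewrite !inE => ->; rewrite orbT.
- by apply/hasP; exists x; rewrite // !inE eqxx.
- by apply: sub_has H => w; rewrite !inE => ->; rewrite orbT.
- by apply/hasP; exists y; rewrite // !inE eqxx.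
Qed.

(** Cuts a path at its first vertex in [P]. When [x] lies in [P], the piece kept uses no arc that
    leaves [x]. *)
Lemma path_first_in E P z s : path (erel E) z s -> has [in P] (z :: s) ->
  exists s1 s2, [/\ s = s1 ++ s2, last z s1 \in P & ~~ has [in P] (belast z s1)].
Proof.
elim: s z => [|w s IH] z; first by rewrite /= orbF => _ zP; exists [::], [::].
rewrite [path _ _ _]/= => /andP [_ pw].
have [zP _|zP] := boolP (z \in P); first by exists [::], (w :: s).
rewrite [has _ _]/= (negbTE zP) /= => H.
have [s1 [s2 [-> l b]]] := IH _ pw H.
by exists (w :: s1), s2; rewrite /= (negbTE zP).
Qed.

Lemma path_last_in E P z s : path (erel E) z s -> has [in P] (z :: s) ->
  exists w s2, [/\ {subset w :: s2 <= z :: s}, w \in P, path (erel E) w s2,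
     last w s2 = last z s & ~~ has [in P] s2].
Proof.
elim: s z => [|w s IH] z.
  by rewrite /= orbF => _ zP; exists z, [::]; split.
rewrite [path _ _ _]/= => /andP [zw pw] H.
have [H1|H1] := boolP (has [in P] (w :: s)).
  have [v [s2 [e vP p l b]]] := IH _ pw H1.
  by exists v, s2; split=> // u /e us; rewrite inE us orbT.
exists z, (w :: s); split=> //=; last by rewrite zw.
by move: H H1 => /=; case: (z \in P) => //= ->.
Qed.

Lemma path_avoid_arc_head E x y z s :
  path (erel E) z s -> x \notin belast z s -> path (erel (E :\ (x, y))) z s.
Proof.
elim: s z => //= w s IH z /andP [zw pw]; rewrite inE negb_or => /andP [xz xs].
by rewrite IH // andbT /erel !inE (zw : (z, w) \in E) andbT; apply: contraNneq xz => -[->].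
Qed.

Lemma path_avoid_arc_tail E x y z s :
  path (erel E) z s -> y \notin s -> path (erel (E :\ (x, y))) z s.
Proof.
elim: s z => //= w s IH z /andP [zw pw]; rewrite inE negb_or => /andP [xz xs].
by rewrite IH // andbT /erel !inE (zw : (z, w) \in E) andbT; apply: contraNneq xz => -[_ ->].
Qed.

(* The k disjoint paths exhaust a target set of size k, so none of them meets it twice. *)
Lemma linked_last k P (h : 'I_k -> V) (f : 'I_k -> seq V) i x : #|P| = k ->
    (forall i, last (h i) (f i) \in P) ->
    (forall (i j : 'I_k) (x : V), x \in h i :: f i -> x \in h j :: f j -> i = j) ->
  x \in P -> x \in h i :: f i -> x = last (h i) (f i).
Proof.
move=> cP lP dj xP xi.
have inj : injective (fun i => last (h i) (f i)).
  by move=> a b ab; apply: (dj _ _ (last (h a) (f a))); [|rewrite ab]; apply: mem_last.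
have im : [set last (h i) (f i) | i : 'I_k] = P.
  apply/eqP; rewrite eqEcard card_imset // card_ord cP leqnn andbT.
  by apply/subsetP => y /imsetP [j _ ->].
move: (xP); rewrite -im => /imsetP [j _ xj].
by rewrite (dj i j x) //; rewrite xj mem_last.
Qed.

(** Dually, the [k] distinct first vertices exhaust [P], so by disjointness a point of [P] lies only
    on the path that it starts. *)
Lemma linked_head k P (h : 'I_k -> V) (f : 'I_k -> seq V) x : #|P| = k ->
    (forall i, h i \in P) ->
    (forall (i j : 'I_k) (x : V), x \in h i :: f i -> x \in h j :: f j -> i = j) ->
  x \in P -> exists2 i, x = h i & forall j, x \in h j :: f j -> j = i.
Proof.
move=> cP lP dj xP.
have inj : injective h.
  by move=> a b ab; apply: (dj _ _ (h a)); [|rewrite ab]; apply: mem_head.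
have im : [set h i | i : 'I_k] = P.
  apply/eqP; rewrite eqEcard card_imset // card_ord cP leqnn andbT.
  by apply/subsetP => y /imsetP [j _ ->].
move: (xP); rewrite -im => /imsetP [j _ xj]; exists j => // i xi.
by apply: (dj i j x) => //; rewrite xj mem_head.
Qed.

(* Göring's proof, by induction on the number of arcs. *)
Theorem menger k E A B :
  (forall S, separates E A B S -> k <= #|S|) -> linked k E A B.
Proof.
have [m] := ubnP #|E|; elim: m => // m IH in E A B *.
rewrite ltnS => cE sep.
have [E0|[[x y] xyE]] := set_0Vmem E.
  (* Without arcs every path is a single vertex, so the intersection of [A] and [B] separates and
     supplies [k] trivial paths. *)
  have kAB : k <= #|A :&: B|.
    apply: sep => z [|w s] zA //= pz zB; first by rewrite !inE zA zB.
    by move: pz; rewrite /erel E0 inE.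
  exists (fun i => enum_val (widen_ord kAB i)), (fun=> [::]); split=> //=.
  - by move=> i; have := enum_valP (widen_ord kAB i); rewrite inE => /andP [].
  - by move=> i; have := enum_valP (widen_ord kAB i); rewrite inE => /andP [].
  - move=> i j z; rewrite !inE => /eqP -> /eqP /enum_val_inj /(congr1 val) /= ij.
    exact: val_inj.
pose E' := E :\ (x, y).
have sE' : E' \subset E by rewrite subsetDl.
have cE' : #|E'| < m by move: cE; rewrite (cardsD1 (x, y)) xyE.
(* If deleting the arc creates no small separator, induction applies directly. Otherwise [S] has
   [k - 1] elements, and adding [x] or [y] yields two separators [P], [Q] of size [k]. *)
case: (classic (exists S, separates E' A B S /\ #|S| < k)) => [[S [sS ltSk]]|nS]; last first.
  apply: linked_mono sE' _; apply: IH => // S sS.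
  by rewrite leqNgt; apply/negP => lt; apply: nS; exists S.
have [sP sQ] := separates_arc sS.
set P := x |: S in sP; set Q := y |: S in sQ.
have cP : #|P| = k.
  by apply/eqP; rewrite eqn_leq sep // andbT /P cardsU1; move: ltSk; case: (_ \notin _); lia.
have cQ : #|Q| = k.
  by apply/eqP; rewrite eqn_leq sep // andbT /Q cardsU1; move: ltSk; case: (_ \notin _); lia.
have xS : x \notin S by move: cP ltSk; rewrite /P cardsU1; case: (x \in S) => //=; lia.
have yS : y \notin S by move: cQ ltSk; rewrite /Q cardsU1; case: (y \in S) => //=; lia.
(* A set separating [A] from [P] without the arc separates [A] from [B] with it: a path cut at its
   first vertex in [P] does not use the arc. The same holds for [Q] and [B], with the last vertex in
   [Q]. *)
have [h1 [f1 [hA pf1 lP uf1 dj1]]] : linked k E' A P.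
  apply: IH => // T sT; apply: sep => z s zA pz zB.
  have [s1 [s2 [es l b]]] := path_first_in pz (sP _ _ zA pz zB).
  have xb : x \notin belast z s1.
    by apply: contra b => xb; apply/hasP; exists x; rewrite // !inE eqxx.
  move: pz; rewrite es cat_path => /andP [pz1 _].
  have := sT _ _ zA (path_avoid_arc_head y pz1 xb) l.
  by rewrite -cat_cons has_cat => ->.
have [h2 [f2 [hQ pf2 lB uf2 dj2]]] : linked k E' Q B.
  apply: IH => // T sT; apply: sep => z s zA pz zB.
  have [w [s2 [sub wQ p l b]]] := path_last_in pz (sQ _ _ zA pz zB).
  have yb : y \notin s2.
    by apply: contra b => xb; apply/hasP; exists y; rewrite // !inE eqxx.
  have := sT _ _ wQ (path_avoid_arc_tail x p yb); rewrite l => /(_ zB).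
  by case/hasP => u us uT; apply/hasP; exists u => //; apply: sub.
(* Switching paths at a common vertex [z] gives a path from [A] to [B] in [E'], which must meet [S].
   As the first family meets [P] only at its ends and the second meets [Q] only at its starts, that
   meeting point is [z]. *)
have cross i j z : z \in h1 i :: f1 i -> z \in h2 j :: f2 j -> z \in S /\ z = h2 j.
  move=> zi zj.
  have [s1 [s2 [e1 l1 b1]]] : exists s1 s2, [/\ f1 i = s1 ++ s2, last (h1 i) s1 = z & True].
    case/splitPl: zi => s1 s2 lz; by exists s1, s2.
  have [t1 [t2 [e2 l2]]] : exists t1 t2, f2 j = t1 ++ t2 /\ last (h2 j) t1 = z.
    case/splitPl: zj => s1' s2' lz; by exists s1', s2'.
  have pp : path (erel E') (h1 i) (s1 ++ t2).
    have := pf1 i; rewrite e1 !cat_path l1 => /andP [-> _] /=.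
    by have := pf2 j; rewrite e2 cat_path l2 => /andP [].
  have lz : last (h1 i) (s1 ++ t2) \in B.
    by rewrite last_cat l1; have := lB j; rewrite e2 last_cat l2.
  have /hasP [w ws wS] := sS _ _ (hA i) pp lz.
  have wP : w \in P by rewrite !inE (wS : w \in S) orbT.
  have wQ : w \in Q by rewrite !inE (wS : w \in S) orbT.
  have zS : z \in S /\ z = w.
    move: ws; rewrite -cat_cons mem_cat => /orP [w1|w2].
      have wl : w = last (h1 i) (f1 i).
        apply: (linked_last cP lP dj1 wP).
        by rewrite e1 -cat_cons mem_cat w1.
      suff s20 : s2 = [::] by move: wl; rewrite e1 s20 cats0 l1 => <-.
      have := uf1 i; rewrite e1 -cat_cons cat_uniq => /and3P [_ /hasPn H _].
      move: wl; rewrite e1 last_cat; case: (s2) H => // a s2' H wl.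
      have /H : w \in a :: s2' by rewrite wl /= mem_last.
      by rewrite /= w1.
    have [j' wj' uj'] := linked_head cQ hQ dj2 wQ.
    have wj : w \in h2 j :: f2 j by rewrite e2 inE mem_cat w2 !orbT.
    have wh : w = h2 j by rewrite (uj' _ wj).
    by have := uf2 j; rewrite e2 -wh /= mem_cat w2 orbT.
  split; first by case: zS.
  have [zS' _] := zS.
  have [|j' zj' uj'] := linked_head cQ hQ dj2 (x := z); first by rewrite !inE zS' orbT.
  by rewrite (uj' _ zj).
(* The path ending at [x] continues across the arc to [y]; every other path continues from its own
   end in [S]. *)
pose nxt z := if z == x then y else z.
have nxtQ i : nxt (last (h1 i) (f1 i)) \in Q.
  by rewrite /nxt; case: eqP => [|nx]; rewrite !inE ?eqxx //; have := lP i; rewrite !inE => /orP [/eqP //|->]; rewrite orbT.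
have /fin_all_exists [s hs] : forall i, exists j, nxt (last (h1 i) (f1 i)) = h2 j.
  by move=> i; have [j] := linked_head cQ hQ dj2 (nxtQ i); exists j.
have s_inj : injective s.
  move=> i j sij; have : nxt (last (h1 i) (f1 i)) = nxt (last (h1 j) (f1 j)) by rewrite !hs sij.
  have H i' : last (h1 i') (f1 i') <> x -> last (h1 i') (f1 i') \in S.
    by have := lP i'; rewrite !inE => /orP [/eqP //|].
  rewrite /nxt; case: eqP => [e1|/H e1]; case: eqP => [e2|/H e2] e.
  - by apply: (dj1 _ _ x); [rewrite -e1|rewrite -e2]; apply: mem_last.
  - by move: yS; rewrite e e2.
  - by move: yS; rewrite -e e1.
  - by apply: (dj1 _ _ (last (h1 i) (f1 i))); [|rewrite e]; apply: mem_last.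
(* The start of the second path is a new vertex only when the arc is crossed; otherwise it is
   already the end of the first path. *)
pose tl i := if last (h1 i) (f1 i) == x then h2 (s i) :: f2 (s i) else f2 (s i).
have tl_sub i z : z \in tl i -> z \in h2 (s i) :: f2 (s i).
  by rewrite /tl; case: ifP => // _; rewrite inE => ->; rewrite orbT.
have cross' i j z : z \in h1 i :: f1 i -> z \in tl j -> False.
  move=> zi zj; have [zS ez] := cross _ _ _ zi (tl_sub _ _ zj).
  move: zj; rewrite /tl; case: eqP => [ej|nj]; last first.
    by have := uf2 (s j) => /= /andP [/negbTE]; rewrite -ez => ->.
  by move: (hs j); rewrite /nxt ej eqxx -ez => ey; move: yS; rewrite ey zS.
exists h1, (fun i => f1 i ++ tl i); split=> //.
- move=> i; rewrite cat_path (sub_path _ (pf1 i)) /=; last by move=> a b; apply: (subsetP sE').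
  have pE : path (erel E) (h2 (s i)) (f2 (s i)).
    by apply: sub_path (pf2 _) => a b; apply: (subsetP sE').
  have := hs i; rewrite /tl /nxt; case: eqP => [-> ey|_ ->] //=.
  by rewrite pE andbT -ey.
- move=> i; have := lB (s i); have := hs i; rewrite last_cat /tl /nxt.
  by case: eqP => // _ ->.
- move=> i; rewrite -cat_cons cat_uniq uf1 /=; apply/andP; split.
    by apply/hasPn => z zt; apply/negP => /= zi; exact: cross' zi zt.
  by have := uf2 (s i); rewrite /tl; case: ifP => //= _ /andP [].
- move=> i j z; rewrite -!cat_cons !mem_cat => /orP [zi|zi] /orP [zj|zj].
  + exact: dj1 zi zj.
  + by case: (cross' _ _ _ zi zj).
  + by case: (cross' _ _ _ zj zi).
  + exact: s_inj (dj2 _ _ _ (tl_sub _ _ zi) (tl_sub _ _ zj)).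
Qed.
End Menger.

(** * Harary graphs *)

Section Harary.
Variables (n k : nat).
Hypotheses (k_ge2 : 2 <= k) (k_lt_n : k < n).
Let j := k./2.

(* The chord length is not reduced modulo [n]: for odd [n] exactly one vertex, [n./2], lies
   on two chords. *)
Definition harary : rel 'I_n := fun u w =>
  let t := (u - w) + (w - u) in
  [&& u != w & [|| t <= k./2, n - k./2 <= t | odd k && (t == n./2)]].

Let j_gt0 : 0 < j. Proof. rewrite /j; lia. Qed.
Let jj_lt_n : j + j < n. Proof. rewrite /j; lia. Qed.
Let n_gt0 : 0 < n. Proof. lia. Qed.

Lemma harary_sym : symmetric harary.
Proof. by move=> u w; rewrite /harary eq_sym [_ - _ + _]addnC. Qed.

(** Unrolls the cycle: arcs of the cycle become intervals of natural numbers, taken modulo [n]. *)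
Definition pos (i : nat) : 'I_n := Ordinal (ltn_pmod i n_gt0).

Lemma pos_ord (x : 'I_n) : pos x = x.
Proof. by apply: val_inj; rewrite /= modn_small. Qed.

Lemma pos_add i : pos (i + n) = pos i.
Proof. by apply: val_inj; rewrite /= modnDr. Qed.

Lemma pos_inj b p q : b <= p < b + n -> b <= q < b + n -> pos p = pos q -> p = q.
Proof.
move=> Hp Hq /(congr1 val) /= H.
wlog le : p q Hp Hq H / p <= q.
  by move=> W; case: (leqP p q) => [|/ltnW] l; [|symmetry]; apply: W.
have /eqP : p == q %[mod n] by rewrite H.
move=> /eqP; rewrite eq_sym eqn_mod_dvd // => /dvdnP [[|c] e]; first by lia.
by have := leq_addr (c * n) n; rewrite -mulSn -e; lia.
Qed.

Lemma harary_step i d : 0 < d <= j -> harary (pos i) (pos (i + d)).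
Proof.
move=> /andP [d0 dj]; rewrite /harary /= -/j -(inj_eq val_inj) /=.
rewrite modnD // (modn_small (_ : d < n)); last by lia.
have := ltn_pmod i n_gt0; move: (i %% n) => a an.
by case: leqP => /= H; lia.
Qed.

(** The first alternative holds when the residue of [i] is below [n - n./2]. Otherwise the chord
    goes back by [n./2], which is forward by [n - n./2]. *)
Lemma harary_chord i : odd k ->
  harary (pos i) (pos (i + n./2)) \/ harary (pos i) (pos (i + (n - n./2))).
Proof.
move=> ok; rewrite /harary /= -/j -!(inj_eq val_inj) /= ok.
rewrite !modnD // (modn_small (_ : n./2 < n)); last by lia.
rewrite (modn_small (_ : n - n./2 < n)); last by lia.
have := ltn_pmod i n_gt0; move: (i %% n) => a an.
case: (leqP n (a + n./2)) => /= H; last by left; lia.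
by right; case: leqP => /= H'; lia.
Qed.

Section Removal.
Variable S : {set 'I_n}.
Let HS : rel 'I_n := fun a b => [&& harary a b, a \notin S & b \notin S].

Let HS_sym : connect_sym HS.
Proof.
apply: sym_connect_sym => a b; rewrite /HS harary_sym.
by rewrite [(a \notin S) && _]andbC.
Qed.

(** Walk forward along the cycle with jumps of length at most [j]. Only [j] consecutive removed
    vertices could stop the walk, and the last hypothesis excludes them. *)
Lemma arc_connect i L : L < n -> pos i \notin S -> pos (i + L) \notin S ->
  (forall t, t + j < L -> exists2 s, s < j & pos (i + t + s).+1 \notin S) ->
  connect HS (pos i) (pos (i + L)).
Proof.
have [m] := ubnP L; elim: m => // m IH in i L *; rewrite ltnS => Lm Ln iS lS H.
have [->|L0] := posnP L; first by rewrite addn0.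
have [Lj|jL] := leqP L j.
  by apply: connect1; rewrite /HS harary_step ?iS ?lS // L0.
have [s sj sS] := H 0 jL; rewrite addn0 in sS.
apply: (@connect_trans _ _ (pos (i + s.+1))).
  by apply: connect1; rewrite /HS harary_step ?addnS ?iS ?sS.
have e : i + L = (i + s.+1) + (L - s.+1) by lia.
rewrite e; apply: IH; rewrite -?e ?addnS //; try lia.
move=> t tL; have [|s' s'j s'S] := H (s.+1 + t); first by lia.
by exists s' => //; move: s'S; rewrite !addnA addnS.
Qed.

Lemma seg_connect p q q' : q < p + n -> q' < p + n -> p <= q -> p <= q' ->
  (forall r, p <= r <= maxn q q' -> pos r \notin S) -> connect HS (pos q) (pos q').
Proof.
move=> qn q'n pq pq' H.
wlog le : q q' qn q'n pq pq' H / q <= q'.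
  move=> W; case: (leqP q q') => [|/ltnW] l; first exact: W.
  by rewrite HS_sym; apply: W; rewrite // maxnC.
have e : q' = q + (q' - q) by lia.
rewrite e; apply: arc_connect; first by lia.
- by apply: H; lia.
- by rewrite -e; apply: H; lia.
- by move=> t tL; exists 0 => //; apply: H; lia.
Qed.

Lemma window_card b (l : seq nat) : uniq l ->
  (forall q, q \in l -> b <= q < b + n) -> (forall q, q \in l -> pos q \in S) ->
  size l <= #|S|.
Proof.
move=> ul wl lS; rewrite -(size_map pos) cardE; apply: uniq_leq_size.
  by rewrite map_inj_in_uniq // => p q /wl Hp /wl Hq; apply: pos_inj Hp Hq.
by move=> x /mapP [q /lS qS ->]; rewrite mem_enum.
Qed.

Lemma run_or_step i L : pos i \notin S -> pos (i + L) \notin S -> L < n ->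
  ~~ connect HS (pos i) (pos (i + L)) ->
  exists2 t, t + j < L & forall s, s < j -> pos (i + t + s).+1 \in S.
Proof.
move=> iS lS Ln nc.
case: (pickP (fun t : 'I_L => (t + j < L) && [forall s : 'I_j, pos (i + t + s).+1 \in S])).
  move=> t /andP [tL /forallP H]; exists (val t) => // s sj.
  exact: (H (Ordinal sj)).
move=> H; case/negP: nc; apply: arc_connect => // t tL.
have tL' : t < L by lia.
have := H (Ordinal tL'); rewrite /= tL /= => /negbT /forallPn [s sS].
by exists (val s); [exact: ltn_ord | exact: sS].
Qed.

(** The runs of length [j] at [b] and [e] leave two gaps. The long chord at the middle of the first
    gap lands in the second one; the parity condition makes this true for both possible chord
    lengths. *)
Lemma chord_between b e : odd k -> b + j < e -> e + j < b + n ->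
  (forall q, b + j <= q < e -> pos q \notin S) ->
  (forall q, e + j <= q < b + n -> pos q \notin S) ->
  odd (e - b - j) || ~~ odd n ->
  exists q1 q2, [/\ b + j <= q1 < e, e + j <= q2 < b + n & HS (pos q1) (pos q2)].
Proof.
move=> ok be eb H1 H2 par.
pose q1 := b + j + (e - b - j).-1./2.
have q1P : b + j <= q1 < e by rewrite /q1; lia.
have q2P : e + j <= q1 + n./2 < b + n /\ e + j <= q1 + (n - n./2) < b + n.
  by rewrite /q1; lia.
case: (harary_chord q1 ok) => hc; [exists q1, (q1 + n./2)|exists q1, (q1 + (n - n./2))];
  split=> //; try (by case: q2P); by rewrite /HS hc H1 // H2 //; case: q2P.
Qed.

(** If [x] and [y] are separated, each of the two arcs between them contains a run of [j] removed
    vertices. Since [S] has fewer than [k] elements, [k] is odd and [S] consists of these two runs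
    only; then a long chord joins the two gaps. *)
Lemma harary_connect x y : #|S| < k -> x \notin S -> y \notin S -> connect HS x y.
Proof.
move=> cS xS yS; apply: contraT => nc.
(* [L] is the forward distance from [x] to [y] on the cycle. *)
pose L := (y + (n - x)) %% n; pose i : nat := x.
have Ln : L < n by rewrite ltn_pmod.
have xi : pos i = x by rewrite pos_ord.
have yi : pos (i + L) = y.
  apply: val_inj; rewrite /= /L modnDmr addnCA subnKC; last exact: ltnW (ltn_ord x).
  by rewrite modnDr modn_small.
have xi' : pos (i + L + (n - L)) = x by rewrite -addnA subnKC ?pos_add // ltnW.
have L0 : 0 < L.
  by rewrite lt0n; apply/eqP => L0; move: nc; rewrite -xi -yi L0 addn0 connect0.
have [||//||t1 t1L R1] := @run_or_step i L; rewrite ?xi ?yi //.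
have [||||t2 t2L R2] := @run_or_step (i + L) (n - L); rewrite ?xi' ?yi //; try lia.
  by rewrite HS_sym.
pose b := (i + t1).+1; pose e := (i + L + t2).+1.
have Rb s : s < j -> pos (b + s) \in S by move=> /R1; rewrite /b addSn.
have Re s : s < j -> pos (e + s) \in S by move=> /R2; rewrite /e addSn.
have inruns q : q \in iota b j ++ iota e j -> pos q \in S.
  rewrite mem_cat !mem_iota => /orP [] /andP [l1 l2].
    by rewrite -(subnKC l1) Rb //; lia.
  by rewrite -(subnKC l1) Re //; lia.
have wruns q : q \in iota b j ++ iota e j -> b <= q < b + n.
  by rewrite mem_cat !mem_iota /b /e; lia.
have uruns : uniq (iota b j ++ iota e j).
  rewrite cat_uniq !iota_uniq andbT /=; apply/hasPn => q.
  by rewrite !mem_iota /b /e; lia.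
have := window_card uruns wruns inruns; rewrite size_cat !size_iota => S2j.
have ok : odd k by rewrite /j in S2j; lia.
have out q : b <= q < b + n -> q \notin iota b j ++ iota e j -> pos q \notin S.
  move=> Hq nq; apply/negP => qS.
  have : size (q :: iota b j ++ iota e j) <= #|S|.
    apply: (@window_card b); first by rewrite /= nq uruns.
      by move=> r; rewrite inE => /orP [/eqP ->|/wruns].
    by move=> r; rewrite inE => /orP [/eqP ->|/inruns].
  rewrite [size _]/= size_cat !size_iota /j; lia.
have H1 q : b + j <= q < e -> pos q \notin S.
  by move=> Hq; apply: out; rewrite ?mem_cat ?mem_iota /b /e in Hq *; lia.
have H2 q : e + j <= q < b + n -> pos q \notin S.
  by move=> Hq; apply: out; rewrite ?mem_cat ?mem_iota /b /e in Hq *; lia.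
have H3 q : b + n + j <= q < e + n -> pos q \notin S.
  move=> Hq; have -> : q = (q - n) + n by lia.
  by rewrite pos_add H1 //; lia.
have [q1 [q2 [Hq1 Hq2 q12]]] : exists q1 q2,
    [/\ b + j <= q1 < e, e + j <= q2 < b + n & connect HS (pos q1) (pos q2)].
  have [par|] := boolP (odd (e - b - j) || ~~ odd n).
    have [||q1 [q2 [Hq1 Hq2 H]]] := chord_between ok _ _ H1 H2 par; rewrite /b /e; try lia.
    by exists q1, q2; split=> //; apply: connect1.
  (* The gaps have total length [n - 2 * j]. If [n] is odd and the first gap is even, the second is
     odd, so the roles are exchanged and the first gap is shifted by [n]. *)
  rewrite negb_or negbK => /andP [e1 e2].
  have [|||||q2 [q1 [Hq2 Hq1 H]]] := @chord_between e (b + n) ok; rewrite ?/b ?/e; try lia.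
  - by move=> q Hq; apply: H2; rewrite /b /e; lia.
  - by move=> q Hq; apply: H3; rewrite /b /e; lia.
  exists (q1 - n), q2; rewrite HS_sym; split; [rewrite /b /e; lia|rewrite /b /e; lia|].
  by rewrite -[X in connect _ _ X]pos_add subnK; [apply: connect1 | lia].
case/negP: nc; rewrite HS_sym -yi -xi -(pos_add i).
apply: connect_trans (connect_trans q12 _).
  apply: (@seg_connect (b + j)); rewrite /b /e in Hq1 *; try lia.
  by move=> r Hr; apply: H1; rewrite /b /e; lia.
apply: (@seg_connect (e + j)); rewrite /b /e in Hq2 *; try lia.
by move=> r Hr; apply: H2; rewrite /b /e; lia.
Qed.
End Removal.
End Harary.

Lemma connect_avoid (V : finType) (e : rel V) u z : u != z -> connect e u z ->
  exists a s, [/\ e u a, path e a s, last a s = z & u \notin a :: s].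
Proof.
move=> uz /connectP [p0 pe el]; move: uz; rewrite el => {el z}.
case/shortenP: pe => -[|a s] pe /= un _; first by rewrite eqxx.
by case/andP: pe => ea pa; case/andP: un => un _ _; exists a, s.
Qed.

Lemma card_ltn_pairs m : #|[pred p : 'I_m * 'I_m | p.1 < p.2]| = 'C(m, 2).
Proof.
rewrite -bin2_sum big_mkord -sum1_card.
rewrite (eq_bigl (fun p : 'I_m * 'I_m => true && (p.1 < p.2))) //.
rewrite -(pair_big_dep xpredT (fun a b : 'I_m => a < b) (fun _ _ => 1)) /=.
rewrite (exchange_big_dep xpredT) //=.
apply: eq_bigr => i _; rewrite -(big_ord_widen _ (fun=> 1)) ?(ltnW (ltn_ord i)) //.
by rewrite sum1_card card_ord.
Qed.

(** * The colouring obtained from a Harary graph *)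

Section HararyColouring.
Variables (n k : nat).
Hypotheses (k_ge2 : 2 <= k) (k_lt_n : k < n).
Notation H := (@harary n k).

(** Menger's theorem is applied to the graph without [u] and [v], between the neighbourhoods of [u]
    and [v]. A separator of size below [k - 1], enlarged by [v] or by [u], still cannot disconnect
    the Harary graph. *)
Lemma harary_long_paths (u v : 'I_n) : u != v ->
  exists (h : 'I_k.-1 -> 'I_n) (f : 'I_k.-1 -> seq 'I_n),
    [/\ forall i, path H u (rcons (h i :: f i) v),
        forall i, uniq (u :: rcons (h i :: f i) v)
      & forall i j x, x \in h i :: f i -> x \in h j :: f j -> i = j].
Proof.
move=> uv.
pose E := [set p : 'I_n * 'I_n | [&& H p.1 p.2, p.1 \notin [set u; v] & p.2 \notin [set u; v]]].
pose A := [set a | H u a && (a != v)]; pose B := [set b | H b v && (b != u)].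
have Hirr a b : H a b -> a != b by case/andP.
have [h [f [hA pf lB uf dj]]] : linked k.-1 E A B.
  apply: menger => S sS; rewrite leqNgt; apply/negP => cS.
  pose S' := S :\: [set u; v].
  have cS' : #|S'| < k.-1 by apply: leq_ltn_trans cS; rewrite subset_leq_card // subsetDl.
  have uS' : u \notin S' by rewrite !inE eqxx.
  have vS' : v \notin S' by rewrite !inE eqxx orbT.
  (* A surviving vertex [z] is joined to [u] while avoiding [v], and to [v] while avoiding [u]; the
     two paths glued at [z] contradict separation. *)
  have [z /and3P [zS zu zv]] : exists z, [&& z \notin S', z != u & z != v].
    have : 0 < #|~: (u |: (v |: S'))|.
      rewrite cardsCs setCK card_ord subn_gt0.
      by rewrite !cardsU1; do 2 case: (_ \notin _); lia.
    by case/card_gt0P => z; rewrite in_setC !in_setU1 !negb_or => /and3P [? ? ?]; exists z; apply/and3P.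
  have c1 : #|v |: S'| < k by rewrite cardsU1; case: (_ \notin _); lia.
  have c2 : #|u |: S'| < k by rewrite cardsU1; case: (_ \notin _); lia.
  have := harary_connect k_ge2 k_lt_n c1 (x := u) (y := z).
  rewrite !in_setU1 (negbTE uv) (negbTE uS') (negbTE zv) (negbTE zS) => /(_ isT isT).
  rewrite eq_sym in zu.
  case/(connect_avoid zu) => a [s [ua pa la ua']].
  have := harary_connect k_ge2 k_lt_n c2 (x := v) (y := z).
  rewrite !in_setU1 eq_sym (negbTE uv) (negbTE vS') eq_sym (negbTE zu) (negbTE zS) => /(_ isT isT).
  rewrite eq_sym in zv.
  case/(connect_avoid zv) => b [t [vb pb lb vb']].
  (* A path that avoids [S'], one end [c] and, after its first step, the other end [w] lies in the
     graph [E] and avoids [S]. *)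
  have sub_out w c q : w != c -> c \in [set u; v] -> w \in [set u; v] ->
      path (fun a b => [&& H a b, a \notin c |: S' & b \notin c |: S']) q.1 q.2 ->
      w \notin q.1 :: q.2 -> q.1 \notin c |: S' ->
      path (erel E) q.1 q.2 /\ ~~ has [in S] (q.1 :: q.2).
    move=> wc cuv wuv; case: q => x q /= px wx xS.
    have out y : y \notin c |: S' -> y != w -> (y \notin [set u; v]) && (y \notin S).
      rewrite in_setU1 negb_or => /andP [yc yS'] yw.
      have yuv : y \notin [set u; v].
        move: cuv wuv wc; rewrite !inE => /orP [] /eqP ec /orP [] /eqP ew;
          by rewrite ec ew ?eqxx // -ec -ew negb_or ?yc ?yw.
      by move: yS'; rewrite yuv in_setD yuv.
    elim: q x px wx xS => [|y q IH] x /=.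
      move=> _; rewrite inE eq_sym => Hw Hx; split=> //; rewrite orbF.
      by case/andP: (out _ Hx Hw).
    case/andP => /and3P [Hxy _ Hy] pq; rewrite inE negb_or => /andP [xw wq] Hx.
    have [p' nh] := IH _ pq wq Hy.
    rewrite eq_sym in xw; case/andP: (out _ Hx xw) => Hx1 Hx2.
    have yw : y != w by move: wq; rewrite inE negb_or eq_sym => /andP [].
    case/andP: (out _ Hy yw) => Hy1 _.
    split; first by rewrite p' andbT /erel inE /= Hxy Hx1 Hy1.
    by rewrite negb_or Hx2.
  have vu : v != u by rewrite eq_sym.
  case/and3P: ua => Hua _ aS; case/and3P: vb => Hvb _ bS.
  have uuv : u \in [set u; v] by rewrite !inE eqxx.
  have vuv : v \in [set u; v] by rewrite !inE eqxx orbT.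
  have [ps ns] := sub_out u v (a, s) uv vuv uuv pa ua' aS.
  have [pt nt] := sub_out v u (b, t) vu uuv vuv pb vb' bS.
  have aA : a \in A by rewrite inE Hua; move: aS; rewrite !inE negb_or => /andP [].
  have bB : b \in B by rewrite inE harary_sym Hvb; move: bS; rewrite !inE negb_or => /andP [].
  have E_sym : symmetric (erel E).
    by move=> x y; rewrite /erel !inE harary_sym; congr (_ && _); rewrite andbC.
  have pt' : path (erel E) (last b t) (rev (belast b t)).
    by rewrite rev_path; apply: sub_path pt => x y; rewrite E_sym.
  have lt' : last (last b t) (rev (belast b t)) = b.
    by case: (t) => //= y t'; rewrite rev_cons last_rcons.
  have pst : path (erel E) a (s ++ rev (belast b t)).
    by rewrite cat_path ps la -lb.
  have lst : last a (s ++ rev (belast b t)) \in B by rewrite last_cat la -lb lt'.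
  have := sS _ _ aA pst lst.
  rewrite -cat_cons has_cat (negbTE (_ : ~~ has _ (a :: s))) //=.
  rewrite has_rev => /hasP [x xb xS]; move/hasPn: nt => /(_ x).
  by rewrite (mem_belast xb) xS => /(_ isT).
have inE' i x : x \in h i :: f i -> x \notin [set u; v].
  have : h i \notin [set u; v].
    have := hA i; rewrite inE => /andP [/Hirr hu hv].
    by rewrite !inE negb_or eq_sym hu.
  have := pf i; elim: (f i) (h i) => [|y s IH] a /=.
    by move=> _ Ha; rewrite mem_seq1 => /eqP ->.
  case/andP => Ey /IH {}IH Ha; rewrite in_cons => /orP [/eqP -> //|]; apply: IH.
  by move: Ey; rewrite /erel inE => /and3P [].
exists h, f; split=> // i.
  rewrite /= rcons_path; have := hA i; rewrite inE => /andP [-> _] /=.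
  have := lB i; rewrite inE => /andP [-> _]; rewrite andbT.
  by apply: sub_path (pf i) => x y; rewrite /erel inE => /andP [].
have Hu : u \notin h i :: f i by apply/negP => /inE'; rewrite !inE eqxx.
have Hv : v \notin h i :: f i by apply/negP => /inE'; rewrite !inE eqxx orbT.
by rewrite cons_uniq mem_rcons in_cons negb_or uv Hu rcons_uniq Hv uf.
Qed.

(** The number [minn x y * n + maxn x y] encodes the unordered pair in base [n]; the successor keeps
    it apart from the common colour 0. *)
Definition harary_colouring (x y : 'I_n) : nat :=
  if H x y then 0 else (minn x y * n + maxn x y).+1.

Lemma harary_colouring_sym : edge_colouring harary_colouring.
Proof. by move=> x y; rewrite /harary_colouring harary_sym minnC maxnC. Qed.

Lemma harary_colouring_connected : mono_k_connected k harary_colouring.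
Proof.
move=> u v uv; have [h [f [ph uh dj]]] := harary_long_paths uv.
pose ls := [seq h i :: f i | i <- enum 'I_k.-1].
have sls : size ls = k.-1 by rewrite size_map size_enum_ord.
have nls i (ik : i < k.-1) : nth [::] ls i = h (Ordinal ik) :: f (Ordinal ik).
  by rewrite (nth_map (Ordinal ik)) ?size_enum_ord // (nth_ord_enum _ (Ordinal ik)).
exists ([::] :: ls); split.
- by rewrite /= sls; lia.
- rewrite /= map_inj_uniq ?enum_uniq ?andbT; first by apply/mapP => -[].
  by move=> i j [e1 e2]; apply: (dj i j (h i)); rewrite ?e1 mem_head.
- move=> s; rewrite inE => /orP [/eqP ->|/mapP [i _ ->]]; rewrite /mono_path.
    split; first by rewrite cons_uniq mem_seq1 uv.
    by exists (harary_colouring u v); rewrite /= eqxx.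
  split=> //; exists 0; apply: sub_path (ph i) => a b.
  by rewrite /harary_colouring => ->.
- move=> [|i] [|j] //= ij jk.
  have jk' : j < k.-1 by lia.
  have ik' : i < k.-1 by lia.
  rewrite !nls; apply/hasPn => x xi; apply/negP => xj.
  by have /(congr1 val) /= := dj _ _ _ xi xj; lia.
Qed.

(** Each vertex starts [k./2] short edges in the forward direction. For odd [k] there are also at
    most [n - n./2] long chords, one for each possible smaller end. *)
Lemma harary_edges : #|[pred p : 'I_n * 'I_n | (p.1 < p.2) && H p.1 p.2]| <= (k * n + 1) %/ 2.
Proof.
have [j ej] : exists j, k./2 = j.+1 by exists k./2.-1; lia.
pose C := [set p : 'I_n * 'I_n | (p.1 < p.2) && ((p.2 - p.1 <= k./2) || (n - k./2 <= p.2 - p.1))].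
pose D := [set p : 'I_n * 'I_n | odd k && (val p.2 == p.1 + n./2)].
(* A short edge is encoded by its start on the cycle and its cyclic length minus one; edges that
   wrap around start at [p.2]. *)
pose f (p : 'I_n * 'I_n) : 'I_n * 'I_j.+1 :=
  if p.2 - p.1 <= k./2 then (p.1, inord (p.2 - p.1).-1) else (p.2, inord (n - (p.2 - p.1)).-1).
have cC : #|C| <= n * k./2.
  have f_inj : {in C &, injective f}.
    move=> [a b] [a' b']; rewrite !inE /f /= => /andP [ab H1] /andP [ab' H2].
    have := ltn_ord a; have := ltn_ord b; have := ltn_ord a'; have := ltn_ord b'.
    case: ifP => l1; case: ifP => l2 => h1 h2 h3 h4 [/(congr1 val) /= e1 /(congr1 val) /=];
      rewrite !inordK; try lia; move=> e2; congr (_, _); apply: val_inj; rewrite /=; lia.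
  rewrite -(card_in_imset f_inj).
  by apply: leq_trans (max_card _) _; rewrite card_prod !card_ord ej.
have cD : #|D| <= odd k * (n - n./2).
  case ok: (odd k); last by rewrite /D ok leqn0 cards_eq0; apply/eqP/setP => p; rewrite !inE.
  have [m em] : exists m, n - n./2 = m.+1 by exists (n - n./2).-1; lia.
  pose g (p : 'I_n * 'I_n) : 'I_m.+1 := inord p.1.
  have g_inj : {in D &, injective g}.
    move=> [a b] [a' b']; rewrite !inE /g /= => /andP [_ /eqP H1] /andP [_ /eqP H2].
    have := ltn_ord a; have := ltn_ord b; have := ltn_ord a'; have := ltn_ord b'.
    move=> h1 h2 h3 h4 /(congr1 val) /=; rewrite !inordK; try lia.
    by move=> e2; congr (_, _); apply: val_inj; rewrite /=; lia.
  rewrite -(card_in_imset g_inj) mul1n em.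
  by apply: leq_trans (max_card _) _; rewrite card_ord.
have sub : #|[pred p : 'I_n * 'I_n | (p.1 < p.2) && H p.1 p.2]| <= #|C :|: D|.
  apply: subset_leq_card; apply/subsetP => -[a b]; rewrite !inE /harary /=.
  case/andP => ab /andP [_]; rewrite (eqP (ltnW ab)) add0n ab /=.
  case/or3P => [->|->|/andP [-> /eqP e]]; rewrite ?orbT //=.
  by apply/orP; right; apply/eqP; lia.
apply: leq_trans sub _; apply: leq_trans (leq_card_setU _ _) _.
apply: leq_trans (leq_add cC cD) _.
have -> : k * n = odd k * n + n * k./2 * 2.
  by rewrite -{1}(odd_double_half k) mulnDl -muln2; lia.
rewrite leq_divRL // mulnDl; move: (n * _ * _) => X.
by case: (odd k); lia.
Qed.

Lemma harary_ncolours : 'C(n, 2) - (k * n + 1) %/ 2 + 1 <= ncolours harary_colouring.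
Proof.
pose ne := enum [pred p : 'I_n * 'I_n | (p.1 < p.2) && ~~ H p.1 p.2].
pose c (p : 'I_n * 'I_n) := harary_colouring p.1 p.2.
have cne : 'C(n, 2) - (k * n + 1) %/ 2 <= size ne.
  rewrite -cardE -card_ltn_pairs leq_subLR; apply: leq_trans (leq_add harary_edges (leqnn _)).
  rewrite -(cardID [pred p | H p.1 p.2] [pred p : 'I_n * 'I_n | p.1 < p.2]).
  apply: leq_add; apply: subset_leq_card; apply/subsetP => p; rewrite !inE //.
  by rewrite andbC.
have : size (0 :: map c ne) <= ncolours harary_colouring; last first.
  by rewrite [size _]/= size_map => H1; apply: leq_trans H1; rewrite addn1 ltnS.
apply: uniq_leq_size.
  have pos p : p \in ne -> c p = (p.1 * n + p.2).+1.
    rewrite mem_enum inE => /andP [lt nH]; rewrite /c /harary_colouring (negbTE nH).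
    by rewrite (minn_idPl (ltnW lt)) (maxn_idPr (ltnW lt)).
  rewrite cons_uniq; apply/andP; split.
    by apply/negP => /mapP [p /pos ->].
  rewrite map_inj_in_uniq ?enum_uniq // => -[a b] [a' b'] /pos -> /pos -> /= [].
  have := ltn_ord b; have := ltn_ord b'; move=> lb' lb e.
  have ea : a = a' :> nat.
    have := congr1 (divn^~ n) e; rewrite !divnMDl ?divn_small ?addn0 //; lia.
  have eb : b = b' :> nat by move: e; rewrite ea; lia.
  by congr (_, _); apply: val_inj.
move=> x; rewrite mem_undup inE => /orP [/eqP ->|/mapP [p pne ->]].
  have n1 : 1 < n by lia.
  apply/mapP; exists (Ordinal (ltnW n1), Ordinal n1); first by rewrite mem_enum inE.
  rewrite /harary_colouring /harary /=; have -> // : 1 <= k./2; lia.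
apply/mapP; exists p => //; move: pne; rewrite !mem_enum !inE.
by case/andP.
Qed.
End HararyColouring.

(** * Connected colour classes *)

Section Connected.
Variable V : finType.
Implicit Types (e : rel V) (X : {set V}).

Lemma path_crossing e X x s : path e x s -> x \in X -> last x s \notin X ->
  exists a b, [/\ e a b, a \in X, b \notin X & a \in belast x s].
Proof.
elim: s x => [|y s IH] x /=; first by move=> _ ->.
case/andP=> exy ps xX lX; have [yX|yX] := boolP (y \in X).
  have [a [b [? ? ? ab]]] := IH _ ps yX lX.
  by exists a, b; split=> //; rewrite in_cons ab orbT.
by exists x, y; split=> //; rewrite mem_head.
Qed.

Lemma connect_crossing e X x y : connect e x y -> x \in X -> y \notin X ->
  exists a b, [/\ e a b, a \in X & b \notin X].
Proof.
case/connectP => s ps -> xX lX; have [a [b [? ? ? _]]] := path_crossing ps xX lX.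
by exists a, b.
Qed.

(* Grow a set [X] from [v], one vertex and hence at least two arcs at a time. *)
Lemma connect_arcs e v : symmetric e ->
  2 * #|connect e v| <= #|[set p : V * V | e p.1 p.2 && connect e v p.1]| + 2.
Proof.
move=> e_sym.
pose arcs X := [set p : V * V | [&& e p.1 p.2, p.1 \in X & p.2 \in X]].
have grow m : m < #|connect e v| -> exists X,
    [/\ X \subset connect e v, v \in X, #|X| = m.+1 & 2 * m <= #|arcs X|].
  elim: m => [|m IH] lt.
    exists [set v]; rewrite cards1 set11; split=> //.
    by apply/subsetP => z /set1P ->; apply: connect0.
  have [X [XC vX cX aX]] := IH (ltnW lt).
  have [y yC yX] : exists2 y, connect e v y & y \notin X.
    apply/exists_inP; rewrite -[X in is_true X]negbK negb_exists_in.
    apply/negP => /forall_inP H; move: lt; rewrite -cX ltnNge => /negP; apply.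
    by apply: subset_leq_card; apply/subsetP => y /H; rewrite negbK.
  have [a [b [eab aX' bX]]] := connect_crossing yC vX yX.
  exists (b |: X); split.
  - apply/subsetP => z; rewrite !inE => /orP [/eqP ->|/(subsetP XC)//].
    by apply: connect_trans (connect1 eab); apply: (subsetP XC).
  - by rewrite !inE vX orbT.
  - by rewrite cardsU1 bX cX.
  have sub : (a, b) |: ((b, a) |: arcs X) \subset arcs (b |: X).
    apply/subsetP => -[p q]; rewrite !inE /= !xpair_eqE => /or3P [].
    - by move=> /andP [/eqP -> /eqP ->]; rewrite eab aX' eqxx orbT.
    - by move=> /andP [/eqP -> /eqP ->]; rewrite e_sym eab aX' eqxx orbT.
    - by case/and3P => -> -> ->; rewrite !orbT.
  apply: leq_trans (subset_leq_card sub); rewrite !cardsU1.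
  have -> : (b, a) \notin arcs X by rewrite inE /= (negbTE bX) andbF.
  have -> : (a, b) \notin (b, a) |: arcs X.
    rewrite !inE /= (negbTE bX) !andbF orbF xpair_eqE.
    by apply: contraNN bX => /andP [_ /eqP ->].
  by move: aX; rewrite /=; lia.
have : 0 < #|connect e v| by apply/card_gt0P; exists v; apply: connect0.
case E : #|connect e v| => [//|m] _; have [|X [XC vX cX aX]] := grow m; first by rewrite E.
suff : #|arcs X| <= #|[set p : V * V | e p.1 p.2 && connect e v p.1]| by lia.
apply: subset_leq_card; apply/subsetP => p; rewrite !inE => /and3P [-> pX _].
exact: (subsetP XC).
Qed.

End Connected.

Section Colouring.
Variables (V T : finType) (col : V -> V -> T).

Definition colour_adj (C : T) : rel V := fun u w => (u != w) && (col u w == C).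

Definition classes_connected :=
  forall C u u' v v', colour_adj C u u' -> colour_adj C v v' -> connect (colour_adj C) u v.

Definition colour_set : {set T} := [set col p.1 p.2 | p in [pred p : V * V | p.1 != p.2]].

(* As in [mono_path], [s i] lists the internal vertices only. *)
Definition long_paths r u v (s : 'I_r -> seq V) (K : 'I_r -> T) :=
  [/\ forall i, s i != [::], forall i, path (colour_adj (K i)) u (rcons (s i) v),
      forall i, uniq (u :: rcons (s i) v)
    & forall i j x, x \in s i -> x \in s j -> i = j].

(** Only [k.-1] paths remain, because one of the [k] paths may be the edge [u v] itself. *)
Definition long_connected k :=
  forall u v, u != v -> exists s K, @long_paths k.-1 u v s K.

End Colouring.

(** * Splitting the colours into connected components *)

Section Recolour.
Variables (n k : nat) (c : 'I_n -> 'I_n -> nat).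
Hypotheses (c_sym : edge_colouring c) (c_conn : mono_k_connected k c).

Definition class_rel (i : nat) : rel 'I_n := fun a b => (a != b) && (c a b == i).

Lemma class_rel_sym i : symmetric (class_rel i).
Proof. by move=> a b; rewrite /class_rel eq_sym c_sym. Qed.

(** The new colour of an edge is the arc set of its component, which keeps the colours in a finite
    type. *)
Definition component (x y : 'I_n) : {set 'I_n * 'I_n} :=
  [set p | class_rel (c x y) p.1 p.2 && connect (class_rel (c x y)) x p.1].

Lemma component_eq x y a b : class_rel (c x y) a b -> connect (class_rel (c x y)) x a ->
  component a b = component x y.
Proof.
move=> /andP [ab /eqP e] xa; apply/setP => p; rewrite !inE e; congr (_ && _).
by rewrite (same_connect (sym_connect_sym (@class_rel_sym _)) xa).
Qed.

Lemma component_mem x y : x != y -> (x, y) \in component x y.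
Proof. by move=> xy; rewrite inE /class_rel /= xy eqxx connect0. Qed.

Lemma component_sym x y : component x y = component y x.
Proof.
have [->//|xy] := eqVneq x y; apply: component_eq; first by rewrite /class_rel xy c_sym eqxx.
by apply: connect1; rewrite /class_rel eq_sym xy eqxx.
Qed.

Lemma component_connected : classes_connected component.
Proof.
move=> C u u' v v' /andP [uu' /eqP eu] /andP [vv' /eqP ev].
have : (v, v') \in component u u' by rewrite eu -ev component_mem.
rewrite inE /= => /andP [_ /connectP [s ps ->]].
suff key t x : path (class_rel (c u u')) x t -> connect (class_rel (c u u')) u x ->
  connect (colour_adj component C) x (last x t) by apply: key ps (connect0 _ _).
elim: t x => [|y t IH] x //= /andP [xy pt] ux.
apply: connect_trans (IH _ pt (connect_trans ux (connect1 xy))).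
apply: connect1; rewrite /colour_adj; case/andP: (xy) => -> _ /=.
by rewrite -eu; apply/eqP; apply: component_eq.
Qed.

(** A monochromatic path stays in one component of its colour class, so the splitting preserves
    it. *)
Lemma component_path i u s : path (fun a b => c a b == i) u s -> uniq (u :: s) ->
  exists C, path (colour_adj component C) u s.
Proof.
move=> ps us; case: s ps us => [|w s] ps us; first by exists set0.
exists (component u w).
have ci : c u w = i by case/andP: ps => /eqP.
have nuw : u != w by move: us; rewrite cons_uniq in_cons negb_or => /andP [/andP []].
have key t x : path (fun a b => c a b == i) x t -> uniq (x :: t) ->
    connect (class_rel (c u w)) u x -> path (colour_adj component (component u w)) x t.
  elim: t x => //= y t IH x /andP [xy pt] /andP [xt ut] ux.
  have nxy : x != y by move: xt; rewrite in_cons negb_or => /andP [].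
  have cxy : class_rel (c u w) x y by rewrite /class_rel nxy ci.
  rewrite /colour_adj nxy (component_eq cxy ux) eqxx /=; apply: IH => //.
  exact: connect_trans ux (connect1 cxy).
by apply: key => //; apply: connect0.
Qed.

(** The [k] lists of internal vertices are distinct, so at most one of them is empty. *)
Lemma component_long_connected : long_connected component k.
Proof.
move=> u v uv; have [ps [sp up mp dj]] := c_conn uv.
pose ls := [seq s <- ps | s != [::]].
have sl : k.-1 <= size ls.
  have := count_predC (fun s => s != [::]) ps; rewrite -size_filter -/ls sp.
  suff : count (predC (fun s => s != [::])) ps <= 1 by lia.
  rewrite (eq_count (a2 := pred1 [::])) ?count_uniq_mem ?leq_b1 //.
  by move=> s; rewrite /= negbK.
have lsP (i : 'I_k.-1) : nth [::] ls i \in ps /\ nth [::] ls i != [::].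
  by have := mem_nth [::] (leq_trans (ltn_ord i) sl); rewrite mem_filter => /andP [].
have djs s t : s \in ps -> t \in ps -> s != t -> forall x, x \in s -> x \in t -> False.
  move=> sps tps st x xs xt.
  wlog lt : s t sps tps st xs xt / index s ps < index t ps.
    move=> W; case: (ltngtP (index s ps) (index t ps)) => l.
    - exact: (W s t).
    - by apply: (W t s) => //; rewrite eq_sym.
    - by move: st; rewrite -(nth_index [::] sps) l (nth_index [::] tps) eqxx.
  have := dj _ _ lt; rewrite -sp index_mem => /(_ tps); rewrite !nth_index //.
  by case/hasP; exists x.
have /fin_all_exists [K HK] : forall i : 'I_k.-1, exists C,
    path (colour_adj component C) u (rcons (nth [::] ls i) v).
  move=> i; have [/mp [uu [i' pi]] _] := lsP i; exact: component_path pi uu.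
exists (fun i => nth [::] ls i), K; split=> //.
- by move=> i; case: (lsP i).
- by move=> i; have [/mp [] ] := lsP i.
- move=> i j x xi xj; have [ip _] := lsP i; have [jp _] := lsP j.
  have [e|ne] := eqVneq (nth [::] ls i) (nth [::] ls j).
    apply/val_inj/eqP; rewrite -(nth_uniq [::] _ _ (_ : uniq ls)) ?e //.
    - exact: leq_trans (ltn_ord _) sl.
    - exact: leq_trans (ltn_ord _) sl.
    - exact: filter_uniq.
  by case: (djs _ _ ip jp ne x xi xj).
Qed.

(** Any arc of a component reveals the old colour, so the splitting loses no colours. *)
Lemma component_ncolours : ncolours c <= #|colour_set component|.
Proof.
pose f (C : {set 'I_n * 'I_n}) := if [pick p in C] is Some p then c p.1 p.2 else 0.
have fE x y : x != y -> f (component x y) = c x y.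
  move=> xy; rewrite /f; case: pickP => [p|/(_ (x, y))]; last by rewrite component_mem.
  by rewrite inE => /andP [/andP [_ /eqP]].
rewrite cardE -(size_map f); apply: uniq_leq_size; first exact: undup_uniq.
move=> i; rewrite mem_undup => /mapP [p]; rewrite mem_enum inE => lt ->.
have np : p.1 != p.2 by rewrite -(inj_eq val_inj) neq_ltn lt.
apply/mapP; exists (component p.1 p.2); last by rewrite fE.
by rewrite mem_enum; apply/imsetP; exists p.
Qed.
End Recolour.

Lemma sum_pred1 (T : finType) (x : T) (F : T -> nat) : \sum_y (x == y) * F y = F x.
Proof.
rewrite (bigD1 x) //= eqxx mul1n big1 ?addn0 // => y.
by rewrite eq_sym => /negbTE ->.
Qed.

Lemma cards_sum (V : finType) (A : {set V}) : #|A| = \sum_w (w \in A).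
Proof. by rewrite -sum1_card big_mkcond. Qed.

(** Serves [loose_enough]: [SD] is the sum of the nontrivial degrees, and [p], [q], [t] count the
    nontrivial colours that miss at least two vertices, exactly one, or none. The three inequalities
    come from degrees, from arcs and from wasted steps. *)
Lemma loose_arith k n SD p q t : 3 <= k <= 5 -> k + 2 <= n -> (k + 1) * n <= SD ->
  4 * p + 2 * (n - 2) * q + 2 * (n - 1) * t <= SD ->
  t * t.-1 * (3 * n - 4) + 8 * (n - 3) * p + 4 * (n - 2) * q + 2 * (n * n.-1) * k.-1
    <= 2 * (n - 2) * SD ->
  k * n + 2 * (p + q + t) <= SD + 2.
Proof.
move=> kk kn H1 H3 H2; rewrite leqNgt; apply/negP => lt.
have [m en] : exists m, n = m + 5 by exists (n - 5); lia.
subst n.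
have e1 : m + 5 - 1 = m + 4 by lia.
have e2 : m + 5 - 2 = m + 3 by lia.
have e3 : m + 5 - 3 = m + 2 by lia.
have e4 : 3 * (m + 5) - 4 = 3 * m + 11 by lia.
have e5 : (m + 5).-1 = m + 4 by lia.
rewrite ?e1 ?e2 ?e3 ?e4 ?e5 in H2 H3; clear e1 e2 e3 e4 e5.
(* The negated goal times [n - 2], and its consequence [n + 3 <= 2 * (p + q + t)] times [n - 4],
   supply the products. Once [q + t] is bounded by 3, finitely many linear cases remain. *)
have P1 : (m + 3) * (SD + 3) <= (m + 3) * (k * (m + 5) + 2 * (p + q + t)) by rewrite leq_mul2l; lia.
have P2 : (m + 1) * (m + 8) <= (m + 1) * (2 * (p + q + t)) by rewrite leq_mul2l; apply/orP; right; lia.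
have h3 : q + t <= 3.
  rewrite leqNgt; apply/negP => h4; clear H2 P1 P2.
  have : 2 * (m + 1) * 4 <= 2 * (m + 1) * (q + t) by rewrite leq_mul2l h4 orbT.
  have [|[|]] : k = 3 \/ k = 4 \/ k = 5 by lia.
  - by move=> ek; subst k; lia.
  - by move=> ek; subst k; lia.
  - by move=> ek; subst k; lia.
have [|[|]] : k = 3 \/ k = 4 \/ k = 5 by lia.
all: move=> ek; subst k.
all: case: t q h3 H1 H2 H3 lt P1 P2 => [|[|[|[|t]]]] [|[|[|[|q]]]]; lia.
Qed.

(** * Degrees in the colour classes and wasted steps *)

Section Degrees.
Variables (V T : finType) (col : V -> V -> T) (k : nat).
Hypothesis col_sym : forall x y, col x y = col y x.
Hypothesis col_conn : classes_connected col.
Hypothesis col_paths : long_connected col k.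
Hypotheses (k_ge2 : 2 <= k) (k_lt_n : k < #|V|).
Let n := #|V|.
Notation cadj := (colour_adj col).
Notation colours := (colour_set col).

Definition deg C v := \sum_w (cadj C v w).
Definition supp C := [set v | 0 < deg C v].
(** Twice the number of edges of colour [C]. *)
Definition arcs C := \sum_v deg C v.

Lemma degE C v : deg C v = #|[set w | cadj C v w]|.
Proof. by rewrite cards_sum; apply: eq_bigr => w _; rewrite inE. Qed.

Lemma cadj_sym C : symmetric (cadj C).
Proof. by move=> u w; rewrite /colour_adj eq_sym col_sym. Qed.

Lemma suppP C v : reflect (exists w, cadj C v w) (v \in supp C).
Proof.
rewrite inE degE card_gt0; apply: (iffP (set0Pn _)) => -[w].
  by rewrite inE; exists w.
by exists w; rewrite inE.
Qed.

Lemma cadj_supp C u w : cadj C u w -> (u \in supp C) && (w \in supp C).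
Proof.
move=> h; apply/andP; split; apply/suppP; first by exists w.
by exists u; rewrite cadj_sym.
Qed.

Lemma deg_notin C v : v \notin supp C -> deg C v = 0.
Proof. by rewrite inE -leqNgt leqn0 => /eqP. Qed.

Lemma deg_in C v : v \in supp C -> 0 < deg C v.
Proof. by rewrite inE. Qed.

Lemma cadj_col u w : u != w -> cadj (col u w) u w.
Proof. by rewrite /colour_adj eqxx andbT. Qed.

Lemma sum_cadj u w : \sum_C (cadj C u w) = (u != w).
Proof.
rewrite -[RHS](sum_pred1 (col u w) (fun=> u != w : nat)); apply: eq_bigr => C _.
by rewrite /colour_adj mulnC; case: (u != w); case: (_ == C).
Qed.

Lemma sum_deg v : (\sum_C deg C v).+1 = n.
Proof.
rewrite exchange_big /= /n -sum1_card [RHS](bigD1 v) //= add1n; congr S.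
rewrite [LHS](bigD1 v) //= sum_cadj eqxx add0n; apply: eq_bigr => w wv.
by rewrite sum_cadj eq_sym wv.
Qed.

Lemma arcsE C : arcs C = #|[set p : V * V | cadj C p.1 p.2]|.
Proof.
rewrite cards_sum /arcs /deg pair_big /=.
by apply: eq_bigr => p _; rewrite inE.
Qed.

Lemma connect_supp C v : v \in supp C -> connect (cadj C) v =i supp C.
Proof.
move=> vC w; apply/idP/idP => [|wC]; last first.
  by case/suppP: vC => v' hv; case/suppP: wC => w' hw; apply: col_conn hv hw.
case/connectP => s; case/lastP: s => [_ -> //|s x].
by rewrite rcons_path last_rcons => /andP [_ /cadj_supp /andP [_ ?]] ->.
Qed.

Lemma arcs_ge C : C \in colours -> 2 * #|supp C| <= arcs C + 2.
Proof.
case/imsetP => p; rewrite inE => np ->.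
have /andP [pC _] := cadj_supp (cadj_col np).
have := connect_arcs p.1 (cadj_sym (col p.1 p.2)).
rewrite (eq_card (connect_supp pC)) arcsE => h; apply: leq_trans h _.
rewrite leq_add2r; apply: subset_leq_card; apply/subsetP => q; rewrite !inE.
by case/andP.
Qed.

Lemma supp_colours C v : v \in supp C -> C \in colours.
Proof.
by case/suppP => w /andP [vw /eqP <-]; apply/imsetP; exists (v, w).
Qed.

Lemma colours_arcs C : C \notin colours -> arcs C = 0.
Proof.
move=> nC; rewrite /arcs big1 // => v _; apply: deg_notin.
by apply: contra nC; apply: supp_colours.
Qed.

Lemma supp_ge2 C : C \in colours -> 1 < #|supp C|.
Proof.
case/imsetP => p; rewrite inE => np ->.
have /andP [p1 p2] := cadj_supp (cadj_col np).
have <- : #|[set p.1; p.2]| = 2 by rewrite cards2 np.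
by apply: subset_leq_card; apply/subsetP => x /set2P [] ->.
Qed.

Lemma sum_arcs : \sum_C arcs C = n * n.-1.
Proof.
rewrite exchange_big /= /n -[#|V| * _]sum_nat_const.
by apply: eq_bigr => v _; rewrite -/n -(sum_deg v).
Qed.

Lemma arcs_even C : exists e, arcs C = 2 * e.
Proof.
pose lt (p : V * V) := enum_rank p.1 < enum_rank p.2.
exists #|[set p : V * V | cadj C p.1 p.2 & lt p]|.
rewrite arcsE -(cardsID [set p | lt p]) mul2n -addnn; congr (_ + _).
  by apply: eq_card => p; rewrite !inE.
pose sw (p : V * V) := (p.2, p.1).
have sw_inj : injective sw by move=> [a b] [c d] [-> ->].
rewrite -[RHS](card_imset _ sw_inj); apply: eq_card => -[a b]; apply/idP/imsetP.
  rewrite !inE /lt /= -leqNgt => /andP [lab cab]; exists (b, a) => //.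
  rewrite inE /= cadj_sym cab ltn_neqAle lab andbT.
  by case/andP: cab => + _; apply: contraNneq => /val_inj /enum_rank_inj ->.
case=> -[c d]; rewrite !inE /lt /= => /andP [cd l] [-> ->].
by rewrite cadj_sym cd -leqNgt ltnW.
Qed.

(** * First and last steps of the long paths *)

Section PathCount.
Variables (u v : V) (r : nat) (s : 'I_r -> seq V) (K : 'I_r -> T).
Hypothesis sK : long_paths col u v s K.

Let fst i := head u (s i).
Let lst i := last u (s i).

Lemma long_first i : [/\ cadj (K i) u (fst i), fst i \in s i & fst i != v].
Proof.
have [ne ps us dj] := sK; rewrite /fst; have := ps i; have := us i.
case: (s i) (ne i) => // x q _; rewrite rcons_cons 2!cons_uniq => /and3P [_ xq _] /andP [c _].
split; [exact: c | exact: mem_head |].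
by apply: contraNneq xq => /= ->; rewrite mem_rcons mem_head.
Qed.

Lemma long_last i : [/\ cadj (K i) v (lst i), lst i \in s i & lst i != u].
Proof.
have [ne ps us dj] := sK; rewrite /lst; have := ps i; have := us i.
case: (s i) (ne i) => // x q _; rewrite rcons_path cons_uniq => /andP [ux _] /andP [_ c].
rewrite cadj_sym c; split=> //=; first exact: mem_last.
by apply: contraNneq ux => <-; rewrite mem_rcons in_cons mem_last orbT.
Qed.

Lemma long_first_inj : injective fst.
Proof.
move=> i j e; have [_ _ _ dj] := sK; have [_ i1 _] := long_first i.
by have [_ j1 _] := long_first j; apply: (dj _ _ (fst i)) => //; rewrite e.
Qed.

Lemma long_last_inj : injective lst.
Proof.
move=> i j e; have [_ _ _ dj] := sK; have [_ i1 _] := long_last i.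
by have [_ j1 _] := long_last j; apply: (dj _ _ (lst i)) => //; rewrite e.
Qed.

(** Disjointness forces the two paths to be the same, and a path without repetition whose first and
    last internal vertices agree has only one. *)
Lemma long_single i j : fst i = lst j -> i = j /\ s i = [:: fst i].
Proof.
move=> e; have [ne ps us dj] := sK; have [_ i1 _] := long_first i.
have [_ j1 _] := long_last j; have ij : i = j by apply: (dj _ _ (fst i)) => //; rewrite e.
split=> //; move: e; rewrite -ij /fst /lst; have := us i.
case: (s i) (ne i) => // x [|y q] _ //=; rewrite mem_rcons => /and3P [_ + _] e.
by rewrite -rcons_cons mem_rcons in_cons e mem_last orbT.
Qed.

(** The first internal vertices are distinct neighbours of [u] other than [v]; the edge [u v]
    contributes the neighbour [v]. *)
Lemma long_count_first C : u != v -> #|[set i | K i == C]| + (col u v == C) <= deg C u.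
Proof.
move=> uv; rewrite degE -(card_imset _ long_first_inj).
have sub : fst @: [set i | K i == C] \subset [set w | cadj C u w] :\ v.
  apply/subsetP => w /imsetP [i]; rewrite inE => /eqP <- ->.
  by have [c _ nv] := long_first i; rewrite !inE nv c.
have := subset_leq_card sub; rewrite (cardsD1 v [set w | cadj C u w]).
by rewrite inE /colour_adj uv /= addnC leq_add2l.
Qed.

Lemma long_count_last C : u != v -> #|[set i | K i == C]| + (col u v == C) <= deg C v.
Proof.
move=> uv; rewrite degE -(card_imset _ long_last_inj).
have sub : lst @: [set i | K i == C] \subset [set w | cadj C v w] :\ u.
  apply/subsetP => w /imsetP [i]; rewrite inE => /eqP <- ->.
  by have [c _ nv] := long_last i; rewrite !inE nv c.
have := subset_leq_card sub; rewrite (cardsD1 u [set w | cadj C v w]).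
by rewrite inE /colour_adj [v == u]eq_sym uv /= [col v u]col_sym addnC leq_add2l.
Qed.

Lemma long_count_sum : \sum_C #|[set i | K i == C]| = r.
Proof.
under eq_bigr do rewrite cards_sum.
rewrite exchange_big /= -[RHS]card_ord -sum1_card; apply: eq_bigr => i _.
under eq_bigr do rewrite inE -[X in nat_of_bool X]andbT -mulnb.
exact: sum_pred1.
Qed.
End PathCount.

Lemma sum_min_deg u v : u != v -> k <= \sum_C minn (deg C u) (deg C v).
Proof.
move=> uv; have [s [K sK]] := col_paths uv.
have -> : k = \sum_C (#|[set i | K i == C]| + (col u v == C)).
  rewrite big_split /= long_count_sum.
  under [X in _ + X]eq_bigr do rewrite -[nat_of_bool _]muln1.
  by rewrite sum_pred1; lia.
apply: leq_sum => C _; rewrite leq_min.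
by rewrite (long_count_first sK) // (long_count_last sK).
Qed.

Definition spanning C := supp C == [set: V].

(* Two edges [uw], [wv] of different colours: [w] cannot both start and end a path from [u] to [v]. *)
Definition bichromatic u w v :=
  [&& col u w != col w v, spanning (col u w) & spanning (col w v)].

(** [F] and [L] are the first and last internal vertices of the long paths, so [2 * k.-1] of the
    [2 * (n - 2)] possible steps are used. Each summand counts steps at [w] that cannot be used. *)
Lemma wasted_pair u v : u != v ->
  2 * k.-1 + \sum_(w | (w != u) && (w != v))
     ((v \notin supp (col u w)) + (u \notin supp (col v w)) + bichromatic u w v) <= 2 * (n - 2).
Proof.
move=> uv; have [s [K sK]] := col_paths uv.
pose F := [set head u (s i) | i : 'I_k.-1]; pose L := [set last u (s i) | i : 'I_k.-1].
have cF : #|F| = k.-1 by rewrite card_imset ?card_ord //; apply: (long_first_inj sK).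
have cL : #|L| = k.-1 by rewrite card_imset ?card_ord //; apply: (long_last_inj sK).
have -> : 2 * (n - 2) = \sum_(w | (w != u) && (w != v)) 2.
  rewrite sum_nat_const mulnC; congr (_ * _).
  rewrite /n -(cardC [set u; v]) cards2 uv addKn; apply: eq_card => w.
  by rewrite !inE negb_or.
have sub (A : {set V}) : #|A| = k.-1 -> (forall w, w \in A -> (w != u) && (w != v)) ->
    k.-1 = \sum_(w | (w != u) && (w != v)) (w \in A).
  move=> <- H; rewrite cards_sum big_mkcond [RHS]big_mkcond; apply: eq_bigr => w _.
  by case: ifP => // /negbT /negP h; case wA: (w \in A) => //; case: h; apply: H.
have FP w : w \in F -> (w != u) && (w != v).
  case/imsetP => i _ ->; have [/andP [c _] _ nv] := long_first sK i.
  by rewrite eq_sym c nv.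
have LP w : w \in L -> (w != u) && (w != v).
  case/imsetP => i _ ->; have [/andP [c _] _ nv] := long_last sK i.
  by rewrite nv eq_sym c.
rewrite mul2n -addnn {1}(sub F cF FP) (sub L cL LP) -!big_split /=.
apply: leq_sum => w /andP [wu wv].
have hF : w \in F -> v \in supp (col u w).
  case/imsetP => i _ ->; have [/andP [_ /eqP ->] _ _] := long_first sK i.
  by have [/cadj_supp /andP [] ] := long_last sK i.
have hL : w \in L -> u \in supp (col v w).
  case/imsetP => i _ ->; have [/andP [_ /eqP ->] _ _] := long_last sK i.
  by have [/cadj_supp /andP [] ] := long_first sK i.
have hB : w \in F -> w \in L -> ~~ bichromatic u w v.
  case/imsetP => i _ -> /imsetP [j _ e]; have [ij _] := long_single sK e.
  have [/andP [_ /eqP c1] _ _] := long_first sK i.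
  have [/andP [_ /eqP c2] _ _] := long_last sK j.
  by rewrite /bichromatic c1 e [col _ v]col_sym c2 ij eqxx.
(* Spanning colours reach both ends, so the third kind of waste never overlaps with the first
   two. *)
have hS : bichromatic u w v -> (v \in supp (col u w)) && (u \in supp (col v w)).
  case/and3P => _ /eqP -> /eqP h; rewrite inE col_sym h inE; done.
move: hF hL hB hS; case: (w \in F); case: (w \in L); case: (bichromatic u w v);
  case: (v \in _); case: (u \in _) => //= h1 h2 h3 h4; try lia;
  by [move: (h1 isT)|move: (h2 isT)|move: (h3 isT isT)|move: (h4 isT)].
Qed.

Lemma sum_deg_weighted u (F : T -> nat) :
  \sum_C deg C u * F C = \sum_w (u != w) * F (col u w).
Proof.
under eq_bigr do rewrite big_distrl /=.
rewrite exchange_big /=; apply: eq_bigr => w _.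
rewrite -(sum_pred1 (col u w) F) big_distrr /=; apply: eq_bigr => C _.
by rewrite mulnA mulnb.
Qed.

Lemma sum_notin (A : {set V}) : \sum_v (v \notin A) = n - #|A|.
Proof.
rewrite /n -(cardsC A) addKn cards_sum.
by apply: eq_bigr => v _; rewrite inE.
Qed.

Definition spanning_pair C C' := [&& C != C', spanning C & spanning C'].

(** Sums [wasted_pair] over ordered pairs. The first two kinds of waste are equal by symmetry and
    pair an arc of [C] with a vertex missed by [C]; the third counts pairs of arcs at the middle
    vertex [w]. *)
Lemma waste_sum :
  2 * (\sum_C arcs C * (n - #|supp C|))
  + \sum_w \sum_C \sum_C' deg C w * (deg C' w * spanning_pair C C')
  + n * n.-1 * (2 * k.-1) <= n * n.-1 * (2 * (n - 2)).
Proof.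
have cn (c : nat) : n * n.-1 * c = \sum_(u : V) \sum_(v : V) (u != v) * c.
  under eq_bigr do rewrite -big_distrl /=.
  rewrite -big_distrl /=; congr (_ * _).
  under eq_bigr => u _ do under eq_bigr => v _ do rewrite -(sum_cadj u v).
  rewrite -sum_arcs /arcs exchange_big /=; apply: eq_bigr => u _.
  by rewrite exchange_big.
pose I (u v w : V) : nat := [&& u != v, w != u & w != v].
have pair u v : (u != v) * (2 * k.-1) + \sum_w I u v w * ((v \notin supp (col u w))
    + (u \notin supp (col v w)) + bichromatic u w v) <= (u != v) * (2 * (n - 2)).
  have [<-|uv] := eqVneq u v.
    by rewrite big1 // => w _; rewrite /I eqxx.
  rewrite !mul1n; apply: (leq_trans _ (wasted_pair uv)).
  rewrite leq_add2l [leqRHS]big_mkcond /=; apply: leq_sum => w _.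
  by rewrite /I uv /=; case: (_ && _); rewrite ?mul0n ?mul1n.
have tot : \sum_(u : V) \sum_(v : V) ((u != v) * (2 * k.-1) + \sum_w I u v w * ((v \notin supp (col u w))
    + (u \notin supp (col v w)) + bichromatic u w v)) <= \sum_(u : V) \sum_(v : V) (u != v) * (2 * (n - 2)).
  by apply: leq_sum => u _; apply: leq_sum => v _; apply: pair.
rewrite -cn in tot; apply: leq_trans tot.
under [leqRHS]eq_bigr do rewrite big_split /=.
rewrite big_split /= -cn addnC leq_add2l.
have split3 : \sum_(u : V) \sum_(v : V) \sum_(w : V) I u v w * ((v \notin supp (col u w))
    + (u \notin supp (col v w)) + bichromatic u w v) =
  \sum_(u : V) \sum_(v : V) \sum_(w : V) I u v w * (v \notin supp (col u w)) +
  \sum_(u : V) \sum_(v : V) \sum_(w : V) I u v w * (u \notin supp (col v w)) +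
  \sum_(u : V) \sum_(v : V) \sum_(w : V) I u v w * bichromatic u w v.
  rewrite -!big_split /=; apply: eq_bigr => u _; rewrite -!big_split /=.
  apply: eq_bigr => v _; rewrite -!big_split /=; apply: eq_bigr => w _.
  by rewrite !mulnDr.
rewrite split3.
have e12 : \sum_(u : V) \sum_(v : V) \sum_(w : V) I u v w * (u \notin supp (col v w)) =
           \sum_(u : V) \sum_(v : V) \sum_(w : V) I u v w * (v \notin supp (col u w)).
  rewrite exchange_big /=; apply: eq_bigr => u _; apply: eq_bigr => v _; apply: eq_bigr => w _.
  by rewrite /I [v == u]eq_sym [(w != v) && _]andbC.
rewrite e12 mul2n -addnn; apply: leq_add.
  have ge : \sum_C arcs C * (n - #|supp C|) <=
      \sum_(u : V) \sum_(v : V) \sum_(w : V) I u v w * (v \notin supp (col u w)).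
    rewrite /arcs; under eq_bigr do rewrite big_distrl /=.
    rewrite exchange_big /=; apply: leq_sum => u _.
    rewrite (sum_deg_weighted u (fun C => n - #|supp C|)) [leqRHS]exchange_big /=.
    apply: leq_sum => w _; rewrite -sum_notin big_distrr /=; apply: leq_sum => v _.
    have [<-|uw] := eqVneq u w; first by rewrite mul0n.
    have /andP [us ws] := cadj_supp (cadj_col uw).
    have [_|vs] := boolP (v \in supp _); first by rewrite muln0.
    have vu : u != v by apply: contraNneq vs => <-.
    have vw : w != v by apply: contraNneq vs => <-.
    by rewrite /I vu vw eq_sym uw.
  by apply: leq_add; apply: ge.
rewrite (eq_bigr (fun w => \sum_u (w != u) * \sum_v (w != v) * spanning_pair (col w u) (col w v))).
  rewrite exchange_big /=; apply: leq_sum => u _.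
  rewrite [leqRHS]exchange_big /=; apply: leq_sum => w _.
  rewrite big_distrr /=; apply: leq_sum => v _.
  rewrite /I /bichromatic /spanning_pair [col u w]col_sym.
  (* For [u = v] the two colours coincide and contribute nothing. *)
  have [->|uv] := eqVneq u v; first by rewrite eqxx /= !muln0.
  by case: (w == u); case: (w == v); rewrite ?mul1n ?mul0n ?muln0 /=.
move=> w _; rewrite -(sum_deg_weighted w (fun C => \sum_v (w != v) * spanning_pair C (col w v))).
apply: eq_bigr => C _; rewrite -big_distrr /=; congr (_ * _).
exact: (sum_deg_weighted w (fun C' => spanning_pair C C')).
Qed.

Let t := #|[set C | spanning C]|.

Lemma spanning_colours C : spanning C -> C \in colours.
Proof.
move=> /eqP sC; have [v] : exists v : V, true by apply/card_gt0P; rewrite -/n; lia.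
by move=> _; apply: (@supp_colours _ v); rewrite sC inE.
Qed.

Lemma spanning_arcs C : spanning C -> 2 * n <= arcs C + 2.
Proof.
move=> sC; have := arcs_ge (spanning_colours sC).
by rewrite (eqP sC) cardsT.
Qed.

(** For positive degrees the product is at least the sum minus one. Over all vertices, two spanning
    colours thus give at least [4 * (n - 1) - n]. *)
Lemma waste_spanning : t * t.-1 * (3 * n - 4) <=
  \sum_w \sum_C \sum_C' deg C w * (deg C' w * spanning_pair C C').
Proof.
have -> : t * t.-1 = \sum_C \sum_C' spanning_pair C C'.
  rewrite {1}/t cards_sum big_distrl /=; apply: eq_bigr => C _; rewrite inE.
  rewrite /spanning_pair; have [sC|sC] := boolP (spanning C); last first.
    by rewrite mul0n big1 // => C' _; rewrite andbF.
  rewrite mul1n /t (cardsD1 C) inE sC /= cards_sum; apply: eq_bigr => C' _.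
  by rewrite !inE eq_sym.
rewrite big_distrl /= [leqRHS]exchange_big /=; apply: leq_sum => C _.
rewrite big_distrl /= [leqRHS]exchange_big /=; apply: leq_sum => C' _.
have [/and3P [_ sC sC']|_] := boolP (spanning_pair C C'); last by rewrite mul0n.
have : \sum_(w : V) (deg C w + deg C' w) <= \sum_(w : V) (deg C w * (deg C' w * 1) + 1).
  apply: leq_sum => w _; rewrite muln1.
  have h1 : 0 < deg C w by apply: deg_in; rewrite (eqP sC) inE.
  have h2 : 0 < deg C' w by apply: deg_in; rewrite (eqP sC') inE.
  by nia.
rewrite !big_split /= sum1_card -/(arcs C) -/(arcs C') mul1n.
rewrite -[#|_|]/n; have := spanning_arcs sC; have := spanning_arcs sC'; lia.
Qed.

Lemma waste_main : 2 * (\sum_C arcs C * (n - #|supp C|)) + t * t.-1 * (3 * n - 4)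
  + n * n.-1 * (2 * k.-1) <= n * n.-1 * (2 * (n - 2)).
Proof.
apply: leq_trans waste_sum; rewrite leq_add2r leq_add2l; exact: waste_spanning.
Qed.

(** A colour on [m < n] vertices wastes at least [2 * (m - 1) * (n - m) >= 2 * (n - 2)]. Spanning
    colours waste as much on average, except for one of them, through their pairs. *)
Lemma colours_bound : 2 * (n - 2) * #|colours|.-1 + n * n.-1 * k.-1 <= n * n.-1 * (n - 2).
Proof.
have n3 : 2 < n by rewrite /n; lia.
have ge : 2 * (n - 2) * (#|colours| - t) <= \sum_C arcs C * (n - #|supp C|).
  have -> : #|colours| - t = \sum_C ((C \in colours) && ~~ spanning C).
    rewrite /t -(cardsID [set C | spanning C] colours) (setIidPr _); last first.
      by apply/subsetP => C; rewrite inE; apply: spanning_colours.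
    rewrite addKn cards_sum; apply: eq_bigr => C _; by rewrite !inE andbC.
  rewrite big_distrr /=; apply: leq_sum => C _.
  have [/andP [Cc nC]|_] := boolP (_ && _); last by rewrite muln0.
  have := arcs_ge Cc; have := supp_ge2 Cc.
  have : #|supp C| < n by rewrite /n -cardsT proper_card // properT.
  move: #|supp C| (arcs C) => m a; rewrite muln1; nia.
have tc : t <= #|colours|.
  by apply: subset_leq_card; apply/subsetP => C; rewrite inE; apply: spanning_colours.
have := waste_main; move: ge tc; move: #|colours| (\sum_C _) t => c X t'.
move: (n * n.-1) => B ge tc main.
have tt : 4 * (n - 2) * t'.-1 <= t' * t'.-1 * (3 * n - 4).
  have [l|l] := leqP t' 1.
    have -> : t'.-1 = 0 by lia.
    by rewrite muln0.
  rewrite [t' * _ * _]mulnAC leq_mul2r; apply/orP; right.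
  have : 2 * (3 * n - 4) <= t' * (3 * n - 4) by rewrite leq_mul2r l orbT.
  by lia.
have e : 2 * (n - 2) * c.-1 <= 2 * (n - 2) * (c - t') + 2 * (n - 2) * t'.-1.
  by rewrite -mulnDr leq_mul2l; lia.
have e1 : 4 * (n - 2) * t'.-1 = 2 * (2 * (n - 2) * t'.-1) by rewrite !mulnA.
have e2 : B * (2 * k.-1) = 2 * (B * k.-1) by rewrite mulnCA.
have e3 : B * (2 * (n - 2)) = 2 * (B * (n - 2)) by rewrite mulnCA.
rewrite e2 e3 in main; rewrite e1 in tt; lia.
Qed.

Definition minus_edge C x y : rel V :=
  fun a b => cadj C a b && ~~ (((a == x) && (b == y)) || ((a == y) && (b == x))).

Lemma minus_edge_sym C x y : symmetric (minus_edge C x y).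
Proof.
move=> a b; rewrite /minus_edge cadj_sym; congr (_ && ~~ _).
by rewrite orbC; congr (_ || _); rewrite andbC.
Qed.

(** * The case k = 2 *)

Section CyclicReach.
Variable v : V.

(* The vertices reached from [v] by a path of length at least 2 in colour [C]. *)
Definition reach2 C := [set z | (z != v) && connect (minus_edge C v z) v z].

Lemma reach2_supp C : reach2 C \subset supp C :\ v.
Proof.
apply/subsetP => z; rewrite inE => /andP [zv /connectP [s]].
rewrite in_setD1 zv; case/lastP: s => [_ /= e|s x]; first by rewrite e eqxx in zv.
rewrite rcons_path last_rcons => /andP [_ /andP [/cadj_supp /andP [_ xs] _]] ->.
exact: xs.
Qed.

(** If [reach2 C] misses a vertex of [supp C] other than [v], the tree bound suffices. Otherwise
    some edge at [v] can be deleted without disconnecting the class, which therefore has one edge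
    more than a tree. *)
Lemma reach2_card C : C \in colours -> 2 * #|reach2 C| + 2 <= arcs C.
Proof.
move=> Cc; have ac := arcs_ge Cc; have m2 := supp_ge2 Cc.
have [vC|vC] := boolP (v \in supp C); last first.
  suff -> : #|reach2 C| = 0 by lia.
  apply/eqP; rewrite cards_eq0; apply/eqP/setP => z; rewrite !inE.
  apply/negP => /andP [zv /connectP [[|x s] /=]]; first by move=> _ e; rewrite e eqxx in zv.
  by case/andP => /andP [/cadj_supp /andP [vs _] _]; rewrite vs in vC.
have sub := subset_leq_card (reach2_supp C).
have := cardsD1 v (supp C); rewrite vC => cD.
have [e|ne] := eqVneq #|reach2 C| #|supp C :\ v|; last by lia.
have [z vz] := suppP _ _ vC.
have zR : z \in reach2 C.
  have -> : reach2 C = supp C :\ v by apply/eqP; rewrite eqEcard reach2_supp e leqnn.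
  by rewrite in_setD1; case/andP: (cadj_supp vz) => _ ->; case/andP: vz => + _; rewrite eq_sym => ->.
pose e' := minus_edge C v z.
have cv : connect e' v z by move: zR; rewrite inE => /andP [].
have sube : subrel (connect (cadj C)) (connect e').
  apply: connect_sub => a b ab; have [ne|] := boolP (minus_edge C v z a b); first exact: connect1.
  rewrite /minus_edge ab negbK => /orP [] /andP [/eqP -> /eqP ->] //.
  by rewrite (sym_connect_sym (@minus_edge_sym C v z)).
have := connect_arcs v (@minus_edge_sym C v z).
have : #|supp C| <= #|connect e' v|.
  apply: subset_leq_card; apply/subsetP => x; rewrite -(connect_supp vC) => vx.
  exact: sube.
suff : #|[set p : V * V | minus_edge C v z p.1 p.2 && connect e' v p.1]| + 2 <= arcs C.
  rewrite -/e'; lia.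
have vz' : (v, z) != (z, v) by rewrite xpair_eqE; case/andP: vz => /negbTE ->.
have <- : #|[set (v, z); (z, v)]| = 2 by rewrite cards2 vz'.
rewrite arcsE -cardsUI [X in _ + X](_ : _ = 0) ?addn0.
  apply: subset_leq_card; apply/subsetP => -[a b]; rewrite !inE /= => /orP [|/orP []].
  - by case/andP => /andP [].
  - by case/eqP => -> ->.
  - by case/eqP => -> ->; rewrite cadj_sym.
apply/eqP; rewrite cards_eq0; apply/eqP/setP => -[a b]; rewrite !inE /= !xpair_eqE.
by rewrite /minus_edge; case: (_ || _); rewrite ?andbF.
Qed.
End CyclicReach.

(** For a fixed [v], one long path to each other vertex shows that the sets [reach2 v C] cover
    [n - 1] vertices; then [reach2_card] is summed over all colours. *)
Lemma colours_bound2 : 2 * #|colours| + 2 * n <= n * n.-1 + 2.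
Proof.
have [v _] : exists v : V, true by apply/card_gt0P; rewrite -/n; lia.
have cov : n.-1 <= \sum_C #|reach2 v C|.
  under eq_bigr do rewrite cards_sum.
  rewrite exchange_big /= (bigD1 v) //=.
  have -> : n.-1 = \sum_(z | z != v) 1.
    by rewrite sum1_card -(cardC1 v) /n; apply: eq_card => z; rewrite !inE.
  apply: leq_trans (leq_addl _ _); apply: leq_sum => z zv.
  rewrite eq_sym in zv; have [s [K sK]] := col_paths zv.
  have i : 'I_k.-1 by apply: Ordinal (_ : 0 < _); lia.
  have [ne ps us dj] := sK.
  suff zR : z \in reach2 v (K i) by rewrite (bigD1 (K i)) //= zR.
  rewrite inE eq_sym zv; apply/connectP; exists (rcons (s i) z); last by rewrite last_rcons.
  (* The path meets [v] and [z] only at its ends and has an internal vertex, so it never uses the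
     edge [v z]. *)
  have [_ _ fz] := long_first sK i; have := ps i; have := us i; have := ne i.
  move: fz; case: (s i) => // x q fz _ uq.
  rewrite !rcons_cons /= in fz uq * => /andP [vx pq]; case/andP: uq => vq uq.
  have vx' : v != x by case/andP: vx.
  rewrite {1}/minus_edge vx (negbTE fz) eqxx (negbTE zv) /=.
  elim: q x pq vq uq vx' {fz vx} => [|y q IH] x /=; rewrite ?andbT.
    move=> xz _ _ vx'; rewrite /minus_edge xz eq_sym (negbTE vx') /=.
    by rewrite [z == v]eq_sym (negbTE zv) andbF.
  case/andP => xy pq; rewrite 2!in_cons !negb_or => /and3P [_ vy vq] /andP [_ uq] vx'.
  rewrite {1}/minus_edge xy eq_sym (negbTE vx') [y == v]eq_sym (negbTE vy) /= andbF /=.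
  by apply: IH => //; rewrite in_cons negb_or vy.
have : \sum_(C in colours) (2 * #|reach2 v C| + 2) <= \sum_(C in colours) arcs C.
  by apply: leq_sum => C Cc; apply: reach2_card.
have -> : \sum_(C in colours) arcs C = n * n.-1.
  rewrite -sum_arcs [RHS](bigID (mem colours)) /= [X in _ = _ + X]big1 ?addn0 //.
  by move=> C /colours_arcs.
rewrite big_split /= sum_nat_const -big_distrr /=.
have -> : \sum_(C in colours) #|reach2 v C| = \sum_C #|reach2 v C|.
  rewrite [RHS](bigID (mem colours)) /= [X in _ = _ + X]big1 ?addn0 // => C nC.
  apply/eqP; rewrite cards_eq0 -subset0; apply: subset_trans (reach2_supp v C) _.
  apply/subsetP => z; rewrite in_setD1 => /andP [_ zC].
  by rewrite (supp_colours zC) in nC.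
by move: cov; lia.
Qed.

(** * Nontrivial colours *)

(** As classes are connected, these are the colours with at least two edges. *)
Definition nontriv := [set C | 2 < #|supp C|].
Definition nadj u w := (u != w) && (col u w \in nontriv).
Definition ndeg v := \sum_(C in nontriv) deg C v.
Definition nlink u v := \sum_(C in nontriv) minn (deg C u) (deg C v).

Lemma ndegE v : ndeg v = #|[set w | nadj v w]|.
Proof.
rewrite cards_sum /ndeg /deg exchange_big /=; apply: eq_bigr => w _.
rewrite inE /nadj big_mkcond -(sum_pred1 (col v w) (fun C => (v != w) && (C \in nontriv) : nat)).
by apply: eq_bigr => C _; rewrite /colour_adj mulnb; case: (C \in _); rewrite ?andbT ?andbF // andbC.
Qed.

(** In [sum_min_deg] a trivial colour contributes only if it is the colour of the edge [u v], and
    then at most 1. *)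
Lemma nlink_ge u v : u != v -> k.-1 + nadj u v <= nlink u v.
Proof.
move=> uv; have := sum_min_deg uv; rewrite (bigID (mem nontriv)) /= -/(nlink u v) => h.
suff : \sum_(C | C \notin nontriv) minn (deg C u) (deg C v) <= ~~ nadj u v.
  by move: h; case: (nadj u v) => /=; lia.
have -> : ~~ nadj u v = \sum_(C | C \notin nontriv) (col u v == C) :> nat.
  rewrite /nadj uv /= big_mkcond -(sum_pred1 (col u v) (fun C => C \notin nontriv : nat)).
  by apply: eq_bigr => C _; case: (C \notin _); rewrite ?muln1 ?muln0.
apply: leq_sum => C; rewrite inE -leqNgt => m2.
have [uC|/deg_notin ->] := boolP (u \in supp C); last by rewrite min0n.
have [vC|/deg_notin ->] := boolP (v \in supp C); last by rewrite minn0.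
have sC : supp C = [set u; v].
  apply/esym/eqP; rewrite eqEcard cards2 uv m2 andbT.
  by apply/subsetP => x /set2P [] ->.
have nb w : cadj C u w -> w = v.
  move=> uw; have /andP [_] := cadj_supp uw; rewrite sC !inE => /orP [] /eqP //.
  by move=> wu; move: uw; rewrite wu /colour_adj eqxx.
have [w uw] := suppP _ _ uC; have wv := nb _ uw; rewrite wv in uw.
have d1 : deg C u <= 1.
  rewrite degE -(cards1 v) subset_leq_card //.
  by apply/subsetP => x; rewrite !inE => /nb ->.
by case/andP: uw => _ ->; apply: leq_trans (geq_minl _ _) d1.
Qed.

Lemma nlink_le u v : nlink u v <= ndeg u.
Proof. by apply: leq_sum => C _; apply: geq_minl. Qed.

Lemma nlink_nadj u v : nadj u v -> k <= nlink u v.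
Proof.
move=> uv; have /andP [ne _] := uv; have := nlink_ge ne; rewrite uv; lia.
Qed.

Lemma exists_nadj v : exists w, nadj v w.
Proof.
have [z zv] : exists z, v != z.
  have : 0 < #|[set~ v]| by rewrite cardsC1 -/n; lia.
  by case/card_gt0P => z; rewrite !inE eq_sym; exists z.
have : 0 < ndeg v.
  apply: leq_trans (nlink_le v z); apply: leq_trans (nlink_ge zv); lia.
by rewrite ndegE => /card_gt0P [w]; rewrite inE; exists w.
Qed.

Lemma ndeg_ge v : k <= ndeg v.
Proof. by have [w vw] := exists_nadj v; apply: leq_trans (nlink_nadj vw) (nlink_le _ _). Qed.

Lemma nontriv_colours C : C \in nontriv -> C \in colours.
Proof.
rewrite inE => m; have [v vC] : exists v, v \in supp C by apply/card_gt0P; lia.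
exact: supp_colours vC.
Qed.

Lemma nontriv_arcs C : C \in nontriv -> 2 * #|supp C| <= arcs C + 2.
Proof. by move/nontriv_colours/arcs_ge. Qed.

Lemma sum_ndeg : \sum_v ndeg v = \sum_(C in nontriv) arcs C.
Proof. by rewrite exchange_big. Qed.

Lemma sum_triv_arcs : \sum_v ndeg v + \sum_(C | C \notin nontriv) arcs C = n * n.-1.
Proof. by rewrite sum_ndeg -sum_arcs [RHS](bigID (mem nontriv)). Qed.

(** Each trivial colour takes at least two of the arcs that the nontrivial colours leave over. *)
Lemma colours_of_ndeg : k * n + 2 * #|nontriv| <= \sum_v ndeg v + 2 ->
  2 * #|colours| + k * n <= n * n.-1 + 2.
Proof.
move=> h; rewrite -sum_triv_arcs.
have e : #|colours| = #|nontriv| + #|colours :\: nontriv|.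
  rewrite -(cardsID nontriv colours) (setIidPr _) //.
  by apply/subsetP => C; apply: nontriv_colours.
have : 2 * #|colours :\: nontriv| <= \sum_(C | C \notin nontriv) arcs C.
  rewrite mulnC -sum_nat_const big_mkcond [leqRHS]big_mkcond /=.
  apply: leq_sum => C _; rewrite in_setD; case: (C \in nontriv) => //=.
  case: ifP => // Cc; have := arcs_ge Cc; have := supp_ge2 Cc; lia.
lia.
Qed.

(** * Nontrivial degrees seen from a fixed vertex *)

Section Local.
Variable v : V.

Definition inc := [set C in nontriv | v \in supp C].
Definition out := [set C in nontriv | v \notin supp C].
Definition ideg z := \sum_(C in inc) deg C z.
Definition nbrs := [set w | nadj v w].

Lemma sum_inc_out (F : T -> nat) :
  \sum_(C in nontriv) F C = \sum_(C in inc) F C + \sum_(C in out) F C.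
Proof.
rewrite (bigID (fun C => v \in supp C)) /=.
by congr (_ + _); apply: eq_bigl => C; rewrite !in_set.
Qed.

Lemma card_inc_out : #|nontriv| = #|inc| + #|out|.
Proof. by rewrite -!sum1_card sum_inc_out. Qed.

Lemma ndeg_split z : ndeg z = ideg z + \sum_(C in out) deg C z.
Proof. exact: sum_inc_out. Qed.

Lemma sum_out_v (F : nat -> nat) : F 0 = 0 -> \sum_(C in out) F (deg C v) = 0.
Proof.
by move=> F0; rewrite big1 // => C; rewrite in_set => /andP [_ /deg_notin ->].
Qed.

Lemma ideg_v : ideg v = ndeg v.
Proof. by rewrite ndeg_split (sum_out_v (F := id)) ?addn0. Qed.

Lemma nlink_inc z : nlink v z = \sum_(C in inc) minn (deg C v) (deg C z).
Proof.
rewrite /nlink sum_inc_out [X in _ + X]big1 ?addn0 // => C.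
by rewrite in_set => /andP [_ /deg_notin ->]; rewrite min0n.
Qed.

Lemma nlink_ideg z : nlink v z <= ideg z.
Proof. by rewrite nlink_inc; apply: leq_sum => C _; apply: geq_minr. Qed.

Lemma sum_ndeg_split : \sum_z ndeg z = \sum_z ideg z + \sum_(C in out) arcs C.
Proof.
under eq_bigr do rewrite ndeg_split.
by rewrite big_split /= [X in _ + X = _]exchange_big.
Qed.

Lemma card_inc_ndeg : #|inc| <= ndeg v.
Proof.
rewrite -ideg_v -sum1_card; apply: leq_sum => C; rewrite in_set => /andP [_].
exact: deg_in.
Qed.

Lemma out_arcs_ge : 2 * #|out| <= \sum_(C in out) arcs C.
Proof.
rewrite mulnC -sum_nat_const; apply: leq_sum => C; rewrite in_set => /andP [CN _].
by have := nontriv_arcs CN; move: CN; rewrite in_set; lia.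
Qed.

(* By the degree bound, every neighbour of such a [z] shares with it a colour avoiding [v]. *)
Lemma tight_out z : ideg z = k.-1 ->
  k.-1 <= \sum_(C in out | z \in supp C) minn k.-1 (#|supp C| - 2).
Proof.
move=> gz.
case: (pickP (fun C => [&& C \in out, z \in supp C & k.-1 <= #|supp C| - 2])).
  move=> C /and3P [Co zC le]; rewrite (bigD1 C) ?Co ?zC //=.
  by rewrite (minn_idPl le) leq_addr.
move=> small.
have -> : \sum_(C in out | z \in supp C) minn k.-1 (#|supp C| - 2) =
          \sum_(C in out | z \in supp C) (#|supp C| - 2).
  apply: eq_bigr => C /andP [Co zC]; apply/minn_idPr.
  by have := small C; rewrite Co zC /= => /negbT; rewrite -ltnNge => /ltnW.
(* The colours at [v] contribute at most [k.-1] to [nlink z w], so each neighbour [w] of [z] shares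
   with [z] a colour avoiding [v]. *)
have sub : ndeg z <= \sum_(C in out | z \in supp C) (#|supp C| - 1).
  rewrite ndegE cards_sum.
  have -> : \sum_(C in out | z \in supp C) (#|supp C| - 1) =
      \sum_w \sum_(C in out | z \in supp C) (w \in supp C :\ z).
    rewrite exchange_big /=; apply: eq_bigr => C /andP [_ zC].
    by rewrite -cards_sum (cardsD1 z (supp C)) zC addKn.
  apply: leq_sum => w _; rewrite inE; have [zw|//] := boolP (nadj z w).
  have : 0 < \sum_(C in out) minn (deg C z) (deg C w).
    have := nlink_nadj zw; rewrite /nlink sum_inc_out.
    suff : \sum_(C in inc) minn (deg C z) (deg C w) <= k.-1 by lia.
    by rewrite -gz; apply: leq_sum => C _; apply: geq_minl.
  rewrite lt0n sum_nat_eq0 => /forall_inPn [C Co]; rewrite -lt0n leq_min => /andP [hz hw].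
  rewrite (bigD1 C) /= ?Co ?inE ?hz //= hw.
  by case/andP: zw => zw _; rewrite eq_sym zw.
have s1 : \sum_(C in out | z \in supp C) 1 <= \sum_(C in out) deg C z.
  rewrite [leqRHS](bigID (fun C => z \in supp C)) /=; apply: leq_trans (leq_addr _ _).
  by apply: leq_sum => C /andP [_ /deg_in].
have e : \sum_(C in out | z \in supp C) (#|supp C| - 1) =
    \sum_(C in out | z \in supp C) (#|supp C| - 2) + \sum_(C in out | z \in supp C) 1.
  rewrite -big_split /=; apply: eq_bigr => C /andP [Co _].
  by move: Co; rewrite !in_set => /andP [m _]; lia.
move: sub; rewrite e ndeg_split gz; lia.
Qed.

(* What a nontrivial colour on [m] vertices contributes beyond the need of the vertices it
   serves in [tight_out], scaled by [k.-1]. *)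
Definition slack s := forall m, 2 < m -> m * minn k.-1 (m - 2) + 2 * k.-1 + s <= k.-1 * (2 * m - 2).

(** A vertex of [Q] has at least [k.-1] in the colours at [v]. Those with exactly [k.-1] form [Q']
    and lack one; by [tight_out] and double counting, the colours avoiding [v] pay for them and keep
    two arcs and the slack. *)
Lemma out_ge s (Q : {set V}) : slack s ->
  (forall z, z \in Q -> (z != v) && ~~ nadj v z) ->
  k.-1 * (k * #|Q| + 2 * #|out|) + s * #|out|
    <= k.-1 * (\sum_(z in Q) ideg z + \sum_(C in out) arcs C).
Proof.
move=> sl HQ.
pose Q' := [set z in Q | ideg z == k.-1].
have gQ z : z \in Q -> k.-1 <= ideg z.
  move=> /HQ /andP [zv _]; rewrite eq_sym in zv.
  by apply: leq_trans (nlink_ideg z); apply: leq_trans (nlink_ge zv); apply: leq_addr.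
have sQ : k * #|Q| <= \sum_(z in Q) ideg z + #|Q'|.
  rewrite mulnC -sum_nat_const (_ : #|Q'| = \sum_(z in Q) (ideg z == k.-1)).
    rewrite -big_split /=; apply: leq_sum => z /gQ.
    by case: eqVneq => /=; lia.
  rewrite -sum1_card big_mkcond [RHS]big_mkcond; apply: eq_bigr => z _.
  by rewrite inE; case: (z \in Q).
have sQ' : k.-1 * #|Q'| <= \sum_(C in out) #|supp C| * minn k.-1 (#|supp C| - 2).
  rewrite mulnC -sum_nat_const.
  apply: (@leq_trans (\sum_(z in Q') \sum_(C in out | z \in supp C) minn k.-1 (#|supp C| - 2))).
    by apply: leq_sum => z; rewrite inE => /andP [_ /eqP]; apply: tight_out.
  rewrite (exchange_big_dep (mem out)) /=; last by move=> z C _ /andP [].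
  apply: leq_sum => C Co; rewrite sum_nat_const leq_mul2r; apply/orP; right.
  by apply: subset_leq_card; apply/subsetP => z; rewrite unfold_in => /and3P [].
have sO : \sum_(C in out) #|supp C| * minn k.-1 (#|supp C| - 2) + (2 * k.-1 + s) * #|out|
    <= k.-1 * \sum_(C in out) arcs C.
  rewrite [_ * #|out|]mulnC -sum_nat_const -big_split /= big_distrr /=.
  apply: leq_sum => C; rewrite in_set => /andP [CN _]; rewrite addnA.
  apply: (leq_trans (sl #|supp C| _)); first by move: CN; rewrite in_set.
  by rewrite leq_mul2l; have := nontriv_arcs CN; lia.
have sQ2 : k.-1 * (k * #|Q|) <= k.-1 * (\sum_(z in Q) ideg z + #|Q'|) by rewrite leq_mul2l sQ orbT.
rewrite !mulnDr in sQ2; rewrite mulnDl -mulnA in sO.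
by rewrite [k.-1 * (k * _ + _)]mulnDr [k.-1 * (\sum_(z in _) _ + _)]mulnDr (mulnCA k.-1 2); lia.
Qed.

Lemma nbrs_ideg z : z \in nbrs -> k <= ideg z.
Proof. by rewrite inE => /nlink_nadj h; apply: leq_trans h (nlink_ideg z). Qed.

Lemma vNnbrs : v \notin nbrs.
Proof. by rewrite inE /nadj eqxx. Qed.

(** Neighbours of [v] have degree at least [k] in the colours at [v]; the remaining vertices are
    covered by [out_ge]. *)
Lemma local_ge s : slack s ->
  k.-1 * (k * n.-1 + ndeg v + 2 * #|out|) + s * #|out| <= k.-1 * \sum_z ndeg z.
Proof.
move=> sl; pose Q := ~: (v |: nbrs).
have HQ z : z \in Q -> (z != v) && ~~ nadj v z by rewrite !inE negb_or.
have cQ : #|Q| + ndeg v = n.-1.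
  have := cardsC (v |: nbrs); rewrite cardsU1 vNnbrs ndegE -/n -/Q -/nbrs; lia.
have e : \sum_z ideg z = ndeg v + \sum_(z in nbrs) ideg z + \sum_(z in Q) ideg z.
  rewrite (bigD1 v) //= ideg_v -addnA; congr (_ + _).
  rewrite (bigID (fun z => z \in nbrs)) /=; congr (_ + _); apply: eq_bigl => z.
    by apply: andb_idl => zn; apply: contraTneq zn => ->; apply: vNnbrs.
  by rewrite in_setC in_setU1 negb_or.
have nb : k * ndeg v <= \sum_(z in nbrs) ideg z.
  rewrite mulnC ndegE -/nbrs -sum_nat_const; apply: leq_sum => z; exact: nbrs_ideg.
have := out_ge sl HQ; rewrite sum_ndeg_split e -cQ.
have : k.-1 * (k * ndeg v + ndeg v) <= k.-1 * (\sum_(z in nbrs) ideg z + ndeg v).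
  by rewrite leq_mul2l leq_add2r nb orbT.
rewrite !mulnDr; lia.
Qed.

End Local.

Definition enough := k * n + 2 * #|nontriv| <= \sum_z ndeg z + 2.

Lemma slack0 : 3 <= k -> slack 0.
Proof.
move=> k3 m m3; have [m' ->] : exists m', m = m'.+3 by exists (m - 3); lia.
by rewrite addn0; have [l|l] := leqP k.-1 (m'.+3 - 2); nia.
Qed.

Lemma local_ge0 v : 3 <= k -> k * n.-1 + ndeg v + 2 * #|out v| <= \sum_z ndeg z.
Proof.
move=> k3; have := local_ge v (slack0 k3); rewrite mul0n addn0 leq_mul2l.
by have -> : (k.-1 == 0) = false by lia.
Qed.

Lemma n_pred c : c * n = c * n.-1 + c.
Proof. by rewrite -mulnSr prednK // /n; lia. Qed.

Lemma one_inc v : 3 <= k -> #|inc v| <= 1 -> enough.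
Proof.
move=> k3 r1; rewrite /enough (card_inc_out v) n_pred.
by have := local_ge0 v k3; have := ndeg_ge v; lia.
Qed.

(** * Vertices of minimal nontrivial degree *)

Section Tight.
Variable v : V.
Hypotheses (k_ge3 : 3 <= k) (tight : ndeg v = k).

(** The degrees at [v] total exactly [k], and a colour missing [x] forfeits its share. *)
Lemma nlink_miss x C : C \in inc v -> x \notin supp C -> nlink v x + deg C v <= k.
Proof.
move=> Ci xC; rewrite -tight -ideg_v nlink_inc /ideg (bigD1 C) //= [leqRHS](bigD1 C) //=.
rewrite (deg_notin xC) minn0 add0n addnC leq_add2l.
by apply: leq_sum => C' _; apply: geq_minl.
Qed.

Lemma nlink_miss2 x C C' : C \in inc v -> C' \in inc v -> C != C' ->
  x \notin supp C -> x \notin supp C' -> nlink v x + deg C v + deg C' v <= k.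
Proof.
move=> Ci Ci' CC xC xC'; rewrite eq_sym in CC.
rewrite -tight -ideg_v nlink_inc /ideg (bigD1 C) //= [leqRHS](bigD1 C) //=.
rewrite (bigD1 C') ?Ci' //= [X in _ <= _ + X](bigD1 C') ?Ci' //=.
rewrite (deg_notin xC) (deg_notin xC') !minn0 !add0n addnAC addnC leq_add2l addnC leq_add2l.
by apply: leq_sum => C'' _; apply: geq_minl.
Qed.

Lemma tight_nbrs C : C \in inc v -> v |: nbrs v \subset supp C.
Proof.
move=> Ci; have vC : v \in supp C by move: Ci; rewrite in_set => /andP [].
apply/subsetP => w /setU1P [-> //|]; rewrite inE => vw; apply: contraT => wC.
have := nlink_miss Ci wC; have := nlink_nadj vw; have := deg_in vC; lia.
Qed.

Lemma card_nbrs : #|v |: nbrs v| = k.+1.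
Proof. by rewrite cardsU1 vNnbrs -ndegE tight. Qed.

(** Every vertex needs [nlink] at least [k - 1], so it can forfeit only one unit; missing two
    colours would cost two. *)
Lemma tight_cover C C' : C \in inc v -> C' \in inc v -> C != C' -> supp C :|: supp C' = setT.
Proof.
move=> Ci Ci' CC; apply/setP => x; rewrite in_setU [RHS]in_setT; apply: contraT.
rewrite negb_or => /andP [xC xC'].
have vC : v \in supp C by move: Ci; rewrite in_set => /andP [].
have vC' : v \in supp C' by move: Ci'; rewrite in_set => /andP [].
have vx : v != x by apply: contraNneq xC => <-.
have := nlink_miss2 Ci Ci' CC xC xC'; have := nlink_ge vx.
have := deg_in vC; have := deg_in vC'; lia.
Qed.

Lemma arcs_pred C : \sum_z (deg C z).-1 + #|supp C| = arcs C.
Proof.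
rewrite cards_sum -big_split /=; apply: eq_bigr => z _; rewrite inE.
by case: (deg C z) => //= d; rewrite addn1.
Qed.

(** A colour of degree 1 at [v] adds at most 1 to [nlink v z], so its excess degrees at [z] are
    gained, in total [arcs C - #|supp C| >= #|supp C| - 2]. The two supports cover all vertices and
    share [v] and its [k] neighbours. *)
Lemma two_leaves C C' : C \in inc v -> C' \in inc v -> C != C' ->
  deg C v = 1 -> deg C' v = 1 -> enough.
Proof.
move=> Ci Ci' CC d1 d2; rewrite /enough (card_inc_out v).
have key z : nlink v z + (deg C z).-1 + (deg C' z).-1 <= ideg v z.
  have CC' : C' != C by rewrite eq_sym.
  rewrite nlink_inc /ideg (bigD1 C) //= [leqRHS](bigD1 C) //=.
  rewrite (bigD1 C') ?Ci' //= [X in _ <= _ + X](bigD1 C') ?Ci' //= d1 d2.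
  have : \sum_(i | (i \in inc v) && (i != C) && (i != C')) minn (deg i v) (deg i z) <=
         \sum_(i | (i \in inc v) && (i != C) && (i != C')) deg i z.
    by apply: leq_sum => C'' _; apply: geq_minr.
  by lia.
have s1 : k + (k.-1 * n.-1 + k) + (arcs C - #|supp C|) + (arcs C' - #|supp C'|) <= \sum_z ideg v z.
  rewrite (bigD1 v) //= ideg_v tight -!addnA leq_add2l.
  have -> : arcs C - #|supp C| = \sum_(z | z != v) (deg C z).-1.
    by rewrite -arcs_pred addnK (bigD1 v) //= d1.
  have -> : arcs C' - #|supp C'| = \sum_(z | z != v) (deg C' z).-1.
    by rewrite -arcs_pred addnK (bigD1 v) //= d2.
  have -> : k.-1 * n.-1 = \sum_(z | z != v) k.-1.
    rewrite sum_nat_const mulnC; congr (_ * _); rewrite /n -(cardC1 v).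
    by apply: eq_card => z; rewrite !inE.
  have ek : \sum_(z | z != v) nadj v z = k.
    by rewrite -[RHS]tight ndegE cards_sum [RHS](bigD1 v) //= inE {2}/nadj eqxx; apply: eq_bigr => z _; rewrite inE.
  rewrite -[X in _ + (X + _)]ek -!big_split /=; apply: leq_sum => z zv; rewrite eq_sym in zv.
  by have := key z; have := nlink_ge zv; lia.
have CN : C \in nontriv by move: Ci; rewrite in_set => /andP [].
have CN' : C' \in nontriv by move: Ci'; rewrite in_set => /andP [].
have cU : n + k.+1 <= #|supp C| + #|supp C'|.
  rewrite -cardsUI (tight_cover Ci Ci' CC) cardsT leq_add2l -card_nbrs.
  by apply: subset_leq_card; rewrite subsetI !tight_nbrs.
have := nontriv_arcs CN; have := nontriv_arcs CN'; have := out_arcs_ge v.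
have := card_inc_ndeg v; rewrite tight (sum_ndeg_split v).
have := n_pred k; have -> : k * n.-1 = k.-1 * n.-1 + n.-1 by rewrite -mulSnr prednK //; lia.
have : 0 < n by rewrite /n; lia.
by lia.
Qed.

(** The other degrees being at least 2 gives [2 * #|inc v| <= k + 1]. Vertices in [supp C] gain the
    excess of [C]; those outside are not neighbours of [v] and fall under [out_ge]. *)
Lemma one_leaf C : C \in inc v -> deg C v = 1 ->
  (forall C', C' \in inc v -> C' != C -> 1 < deg C' v) -> enough.
Proof.
move=> Ci d1 others; rewrite /enough (card_inc_out v).
have CN : C \in nontriv by move: Ci; rewrite in_set => /andP [].
have vC : v \in supp C by move: Ci; rewrite in_set => /andP [].
have r : 2 * #|inc v| <= k.+1.
  rewrite -tight -ideg_v /ideg (bigD1 C) //= d1.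
  rewrite mulnC -sum_nat_const (bigD1 C) //=.
  have : \sum_(i | (i \in inc v) && (i != C)) 2 <= \sum_(i | (i \in inc v) && (i != C)) deg i v.
    by apply: leq_sum => C' /andP [h1 h2]; apply: others.
  by lia.
have key z : nlink v z + (deg C z).-1 <= ideg v z.
  rewrite nlink_inc /ideg (bigD1 C) //= [leqRHS](bigD1 C) //= d1 addnAC leq_add //.
    by lia.
  by apply: leq_sum => C' _; apply: geq_minr.
have s1 : k + (k.-1 * #|supp C|.-1 + k) + (arcs C - #|supp C|) <= \sum_(z in supp C) ideg v z.
  rewrite (bigD1 v) //= ideg_v tight -!addnA leq_add2l.
  have -> : arcs C - #|supp C| = \sum_(z in supp C | z != v) (deg C z).-1.
    rewrite -arcs_pred addnK (bigID (mem (supp C))) /= [X in _ + X]big1 ?addn0.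
      by rewrite (bigD1 v) //= d1.
    by move=> z /deg_notin ->.
  have -> : k.-1 * #|supp C|.-1 = \sum_(z in supp C | z != v) k.-1.
    rewrite sum_nat_const mulnC; congr (_ * _); rewrite (cardsD1 v) vC /=.
    by apply: eq_card => z; rewrite [RHS]unfold_in in_setD1 andbC.
  have ek : \sum_(z in supp C | z != v) nadj v z = k.
    rewrite -[RHS]tight ndegE cards_sum [RHS](bigID (mem (supp C))) /= [X in _ = _ + X]big1 ?addn0.
      by rewrite [RHS](bigD1 v) //= inE {2}/nadj eqxx; apply: eq_bigr => z _; rewrite inE.
    move=> z zC; rewrite inE; apply/eqP; rewrite eqb0; apply: contra zC => vz.
    by apply: (subsetP (tight_nbrs Ci)); rewrite !inE vz orbT.
  rewrite -[X in _ + (X + _)]ek -!big_split /=; apply: leq_sum => z /andP [_ zv]; rewrite eq_sym in zv.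
  by have := key z; have := nlink_ge zv; lia.
have s2 : k * #|~: supp C| + 2 * #|out v| <=
    \sum_(z in ~: supp C) ideg v z + \sum_(C in out v) arcs C.
  have := @out_ge v 0 (~: supp C) (slack0 k_ge3); rewrite mul0n addn0 leq_mul2l.
  have -> : (k.-1 == 0) = false by lia.
  apply=> z; rewrite in_setC => zC; apply/andP; split; first by apply: contraNneq zC => ->.
  by apply: contra zC => vz; apply: (subsetP (tight_nbrs Ci)); rewrite !inE vz orbT.
have e : \sum_z ideg v z = \sum_(z in supp C) ideg v z + \sum_(z in ~: supp C) ideg v z.
  by rewrite (bigID (mem (supp C))) /=; congr (_ + _); apply: eq_bigl => z; rewrite ?in_setC.
have := nontriv_arcs CN; rewrite (sum_ndeg_split v) e.
have <- : #|supp C| + #|~: supp C| = n by rewrite cardsC.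
have m0 : 0 < #|supp C| by apply/card_gt0P; exists v.
rewrite mulnDr.
have -> : k * #|supp C| = k.-1 * #|supp C|.-1 + k.-1 + #|supp C|.
  by rewrite -{1}(prednK (_ : 0 < k)) ?mulSn -?mulnSr ?prednK ?[_ + k.-1 * _]addnC //; lia.
by lia.
Qed.
End Tight.

Lemma tight_leaf_free z C : 3 <= k -> ~~ enough -> ndeg z = k -> C \in inc z -> 1 < deg C z.
Proof.
move=> k3 nen tz Ci; rewrite ltnNge; apply: contra nen => d1.
have {}d1 : deg C z = 1.
  by apply/eqP; rewrite eqn_leq d1 deg_in //; move: Ci; rewrite in_set => /andP [].
have [/existsP [C' /and3P [Ci' CC d2]]|] := boolP [exists C', [&& C' \in inc z, C' != C & deg C' z == 1]].
  by apply: (two_leaves k3 tz Ci Ci' _ d1 (eqP d2)); rewrite eq_sym.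
rewrite negb_exists => /forallP h; apply: (one_leaf k3 tz Ci d1) => C' Ci' CC.
have := h C'; rewrite Ci' CC /= => ne; rewrite ltn_neqAle eq_sym ne deg_in //.
by move: Ci'; rewrite in_set => /andP [].
Qed.

Lemma long_nontriv u v r (s : 'I_r -> seq V) K i : u != v ->
  long_paths col u v s K -> K i \in nontriv.
Proof.
move=> uv sK; have [c1 _ n1] := long_first sK i; have [c2 _ _] := long_last sK i.
have /andP [uC wC] := cadj_supp c1; have /andP [vC _] := cadj_supp c2.
rewrite inE; apply: (@leq_trans #|u |: [set head u (s i); v]|).
  rewrite cardsU1 cards2 n1 !inE negb_or uv andbT.
  by case/andP: c1 => ->.
by apply: subset_leq_card; apply/subsetP => x /setU1P [->//|/set2P [] ->].
Qed.

(* Both [C]-neighbours of [z] are its neighbours on the cycle. *)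
Lemma cycle_closed C (L : seq V) z w : cycle (cadj C) L -> uniq L -> 2 < size L ->
  z \in L -> deg C z = 2 -> cadj C z w -> w \in L.
Proof.
move=> cL uL sL zL d2 zw; case/rot_to: (zL) => i q eq.
rewrite -(mem_rot i) eq; rewrite -(rot_uniq i) eq in uL; rewrite -(rot_cycle i) eq in cL.
rewrite -(size_rot i) eq in sL; case: q eq uL cL sL => [|y [|y' q]] // _ uL cL _.
move: cL; rewrite /cycle rcons_path => /andP [/= /andP [zy _] lz].
set l := last y' q in lz.
have yl : y != l.
  by move: uL => /= /and3P [_ + _]; apply: contraNneq => ->; rewrite mem_last.
suff : w \in [set y; l].
  rewrite !inE => /orP [] /eqP ->; first by rewrite eqxx orbT.
  by rewrite -(in_cons y') mem_last !orbT.
suff -> : [set y; l] = [set w | cadj C z w] by rewrite inE.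
apply/eqP; rewrite eqEcard cards2 yl -degE d2 andbT.
by apply/subsetP => x; rewrite !inE => /orP [] /eqP ->; rewrite // cadj_sym.
Qed.

(** The path must leave [X], which is possible only at [e]; as [e] is neither end, it is
    internal. *)
Lemma path_through (X : {set V}) C u b s e : path (cadj C) u (rcons s b) ->
  u \in X -> b \notin X -> u != e ->
  (forall a w, cadj C a w -> a \in X -> w \notin X -> a = e) -> e \in s.
Proof.
move=> ps uX bX ue H.
have [|a [w [aw aX wX ab]]] := path_crossing ps uX; first by rewrite last_rcons.
have ea := H _ _ aw aX wX; move: ab; rewrite belast_rcons ea in_cons.
by rewrite eq_sym (negbTE ue).
Qed.

(** * Exactly two nontrivial colours and at most one exceptional vertex *)

Section TwoSpanning.
Variables (S1 S2 : T) (v e : V).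
Hypotheses (k_ge4 : 4 <= k) (S12 : S1 != S2).
Hypothesis only2 : forall C, C \in nontriv -> C = S1 \/ C = S2.
Hypotheses (S1N : S1 \in nontriv) (S2N : S2 \in nontriv).
Hypotheses (ve : v != e) (d1v : deg S1 v = 2).
Hypothesis tight_but : forall z, z != e -> ndeg z = k.

Lemma sum_nontriv2 (F : T -> nat) : \sum_(C in nontriv) F C = F S1 + F S2.
Proof.
rewrite (bigD1 S1) //= (bigD1 S2) /=; last by rewrite S2N eq_sym S12.
rewrite big1 ?addn0 // => C /andP [/andP [CN c1] c2].
by case: (only2 CN) => e'; [move: c1|move: c2]; rewrite e' eqxx.
Qed.

Lemma count2 a b r (s : 'I_r -> seq V) K : a != b -> long_paths col a b s K ->
  #|[set i | K i == S1]| + #|[set i | K i == S2]| = r.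
Proof.
move=> ab sK; rewrite -[RHS](long_count_sum K) (bigID (mem nontriv)) /=.
rewrite (sum_nontriv2 (fun C => #|[set i | K i == C]|)) [X in _ = _ + X]big1 ?addn0 // => C nC.
apply/eqP; rewrite cards_eq0; apply/eqP/setP => i; rewrite !inE; apply/negP => /eqP Ki.
by move: nC; rewrite -Ki (long_nontriv i ab sK).
Qed.

(** Adjacent vertices of degree [k] have [nlink] at least [k], hence equal degrees in both colours.
    So the set of vertices of [S1]-degree 2, together with [e], can be left only at [e], but two
    disjoint paths cannot both pass through [e]. *)
Lemma deg2_everywhere z : z != e -> deg S1 z = 2.
Proof.
move=> ze; apply/eqP; apply: contraT => dz.
pose X := e |: [set z | deg S1 z == 2].
have vX : v \in X by rewrite !inE d1v eqxx orbT.
have zX : z \notin X by rewrite !inE negb_or ze.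
have vz : v != z by apply: contraNneq zX => <-.
have leave C a w : C \in nontriv -> cadj C a w -> a \in X -> w \notin X -> a = e.
  move=> CN aw aX; rewrite !inE negb_or => /andP [we dw].
  move: aX; rewrite !inE => /orP [/eqP //|/eqP da]; apply/eqP; apply: contraT => ae.
  have naw : nadj a w by case/andP: aw => h /eqP h'; rewrite /nadj h h'.
  have := nlink_nadj naw; have := tight_but ae; have := tight_but we.
  rewrite /ndeg /nlink !sum_nontriv2 da; move/eqP: dw; clear; lia.
have [s [K sK]] := col_paths vz; have [_ ps us dj] := sK.
have through i : e \in s i.
  by apply: (path_through (ps i) vX zX ve) => a w; apply: leave; apply: long_nontriv sK.
have h1 : 1 < k.-1 by clear - k_ge4; lia.
have h0 := ltnW h1.
by have /(congr1 val) := dj (Ordinal h0) (Ordinal h1) e (through _) (through _).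
Qed.

(** Between [v] and an [S1]-neighbour [a], degrees force a long path of colour [S1], which the edge
    [v a] closes to a cycle, and one of colour [S2], whose first vertex [b] is off the cycle.
    Between [v] and [b] at least two paths have colour [S1]; both must leave the cycle at [e]. *)
Lemma two_spanning_absurd : False.
Proof.
have d2v : deg S2 v = k - 2.
  by have := tight_but ve; rewrite /ndeg sum_nontriv2 d1v; lia.
have [a va] : exists a, cadj S1 v a by apply/suppP; rewrite inE d1v.
have nva : v != a by case/andP: va.
have cva : col v a = S1 by case/andP: va => _ /eqP.
have [s [K sK]] := col_paths nva; have [ne ps us dj] := sK.
have c1 := long_count_first sK S1 nva; have c2 := long_count_first sK S2 nva.
have c3 := count2 nva sK; rewrite cva eqxx d1v in c1.
rewrite cva (negbTE S12) d2v in c2.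
have [i1] : exists i, i \in [set i | K i == S1] by apply/card_gt0P; lia.
rewrite inE => /eqP Ki1.
have [i2] : exists i, i \in [set i | K i == S2] by apply/card_gt0P; lia.
rewrite inE => /eqP Ki2.
have [vb bs ba] := long_first sK i2; set b := head v (s i2) in vb bs ba; rewrite Ki2 in vb.
have nvb : v != b by case/andP: vb.
have cvb : col v b = S2 by case/andP: vb => _ /eqP.
pose L := v :: rcons (s i1) a; pose X := [set z | z \in L].
have cL : cycle (cadj S1) L.
  rewrite /L /cycle rcons_path -Ki1 ps last_rcons /= Ki1 cadj_sym; exact: va.
have sL : 2 < size L by rewrite /= size_rcons; have := ne i1; case: (s i1).
have vX : v \in X by rewrite inE mem_head.
have bX : b \notin X.
  rewrite inE in_cons eq_sym (negbTE nvb) /= mem_rcons in_cons (negbTE ba) /=.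
  apply/negP => bi1; move: S12; rewrite -Ki1 -Ki2 (dj i1 i2 b) ?eqxx //.
have [s' [K' sK']] := col_paths nvb; have [_ ps' us' dj'] := sK'.
have c2' := long_count_first sK' S2 nvb; have c3' := count2 nvb sK'.
rewrite cvb eqxx d2v in c2'.
(* The edge [v b] uses one of the [k - 2] arcs of colour [S2] at [v], so at most [k - 3] of the
   [k - 1] long paths have that colour. *)
have /card_gt1P [j1 [j2 [J1 J2 j12]]] : 1 < #|[set i | K' i == S1]|.
  by clear - k_ge4 c2' c3'; lia.
have through j : j \in [set i | K' i == S1] -> e \in s' j.
  rewrite inE => /eqP Kj; apply: (path_through (ps' j) vX bX ve) => x w; rewrite Kj => xw.
  rewrite in_set => xL; rewrite in_set => wL; apply/eqP; apply: contraT => xe.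
  by rewrite (cycle_closed cL (us i1) sL xL (deg2_everywhere xe) xw) in wL.
by move: j12; rewrite (dj' _ _ _ (through _ J1) (through _ J2)) eqxx.
Qed.
End TwoSpanning.

Lemma sum_ndeg_even : exists h, \sum_z ndeg z = 2 * h.
Proof.
rewrite sum_ndeg; elim/big_rec: _ => [|C x _ [h ->]]; first by exists 0.
by have [h' ->] := arcs_even C; exists (h' + h); rewrite mulnDr.
Qed.

Lemma slack3 : k = 4 -> slack 3.
Proof. by move=> k4 m m3; rewrite k4 /=; case: (leqP 3 (m - 2)) => l; nia. Qed.

Lemma slack5 : k = 5 -> slack 5.
Proof. by move=> k4 m m3; rewrite k4 /=; case: (leqP 4 (m - 2)) => l; nia. Qed.

(** Without leaves at [v], and by [one_inc], exactly two colours meet [v], and one of them has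
    degree 2 there since [k <= 5]. If no other nontrivial colour exists, [two_spanning_absurd]
    applies. *)
Lemma tight_enough v : 3 <= k <= 5 -> ndeg v = k -> enough.
Proof.
case/andP => k3 k5 tv; apply: contraT => nen.
have lf C : C \in inc v -> 1 < deg C v := tight_leaf_free k3 nen tv.
have r2 : 2 * #|inc v| <= k.
  by rewrite mulnC -sum_nat_const -tv -ideg_v; apply: leq_sum.
have r1 : 1 < #|inc v| by rewrite ltnNge; apply: contra nen; apply: one_inc.
have r : #|inc v| = 2 by lia.
have k4 : 4 <= k by lia.
have [o0|o0] := posnP #|out v|; last first.
  case/negP: nen; rewrite /enough (card_inc_out v) r n_pred.
  (* The slack of a colour avoiding [v] supplies the missing two arcs; for [k = 4] and a single such
     colour it gives one, and parity the other. *)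
  have [h eh] := sum_ndeg_even; rewrite eh.
  have [ek|ek] : k = 4 \/ k = 5 by lia.
    by have := local_ge v (slack3 ek); rewrite tv eh ek /=; lia.
  by have := local_ge v (slack5 ek); rewrite tv eh ek /=; lia.
have /eqP/cards2P [S1 [S2 [S12 eI]]] := r.
have eN : nontriv = [set S1; S2].
  rewrite -eI; apply/setP => C; rewrite [RHS]in_set; case CN : (C \in nontriv) => //=.
  suff -> : v \in supp C by []; apply: contraT => vC; move/eqP: o0; rewrite cards_eq0 => /eqP o0.
  by have : C \in out v by [rewrite in_set CN]; rewrite o0 inE.
have S1N : S1 \in nontriv by rewrite eN !inE eqxx.
have S2N : S2 \in nontriv by rewrite eN !inE eqxx orbT.
have only2 C : C \in nontriv -> C = S1 \/ C = S2.
  by rewrite eN !inE => /orP [] /eqP; auto.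
(* Failure of [enough] with two nontrivial colours leaves total excess at most 1, hence at most one
   vertex [e] of degree above [k]. If there is none, any neighbour of [v] serves as [e]. *)
have sx : \sum_z (ndeg z - k) <= 1.
  have : \sum_z (ndeg z - k) + k * n = \sum_z ndeg z.
    rewrite mulnC /n -sum_nat_const -big_split /=; apply: eq_bigr => z _.
    by rewrite subnK // ndeg_ge.
  move: nen; rewrite /enough (card_inc_out v) r o0; lia.
have [e ve tb] : exists2 e, v != e & forall z, z != e -> ndeg z = k.
  have [/existsP [e te]|] := boolP [exists e, ndeg e != k].
    exists e; first by apply: contraNneq te => <-; rewrite tv.
    move=> z ze; move: sx; rewrite (bigD1 e) //= (bigD1 z) //=.
    by have := ndeg_ge e; have := ndeg_ge z; move/eqP: te; lia.
  rewrite negb_exists => /forallP h.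
  have [e ve] := exists_nadj v; exists e; first by case/andP: ve.
  by move=> z _; apply/eqP; rewrite -[_ == _]negbK.
have inc12 : S1 \in inc v /\ S2 \in inc v by rewrite eI !inE !eqxx orbT.
have d12 : deg S1 v + deg S2 v = k by rewrite -tv /ndeg (sum_nontriv2 S12 only2 S1N S2N).
have l1 := lf _ inc12.1; have l2 := lf _ inc12.2.
have [d|d] : deg S1 v = 2 \/ deg S2 v = 2 by lia.
  by case: (two_spanning_absurd k4 S12 only2 S1N S2N ve d tb).
rewrite eq_sym in S12; have only2' C : C \in nontriv -> C = S2 \/ C = S1 by move/only2; tauto.
by case: (two_spanning_absurd k4 S12 only2' S2N S1N ve d tb).
Qed.

(** * No vertex of minimal nontrivial degree *)

Lemma ndeg_le v : ndeg v <= n.-1.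
Proof.
rewrite ndegE /n -(cardsC1 v); apply: subset_leq_card; apply/subsetP => w.
by rewrite !inE eq_sym => /andP [].
Qed.

(** Nontrivial colours are sorted by the number of vertices they miss: at least two ([P]), one ([Q])
    or none ([S]). Their waste and arc counts feed [loose_arith]. *)
Lemma loose_enough : 3 <= k <= 5 -> (forall v, k < ndeg v) -> enough.
Proof.
move=> kk loose.
have nk : k + 2 <= n.
  have [v _] : exists v : V, true by apply/card_gt0P; rewrite -/n; lia.
  by have := loose v; have := ndeg_le v; lia.
pose P := [set C in nontriv | #|supp C| <= n - 2].
pose Q := [set C in nontriv | #|supp C| == n.-1].
pose S := [set C | spanning C].
have m_le C : #|supp C| <= n by apply: max_card.
have spE C : spanning C = (#|supp C| == n).
  apply/eqP/eqP => [->|e]; first by rewrite cardsT.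
  by apply/eqP; rewrite eqEcard subsetT cardsT e leqnn.
have split3 (F : T -> nat) : \sum_(C in nontriv) F C =
    \sum_(C in P) F C + \sum_(C in Q) F C + \sum_(C in S) F C.
  rewrite big_mkcond /= [\sum_(C in P) _]big_mkcond [\sum_(C in Q) _]big_mkcond.
  rewrite [\sum_(C in S) _]big_mkcond -!big_split /=; apply: eq_bigr => C _.
  rewrite !in_set spE; have := m_le C; move: #|supp C| => m mn.
  have [l|l] := leqP 3 m; last first.
    by have -> : (m == n) = false by lia.
  have [h|h] := leqP m (n - 2).
    have -> : (m == n.-1) = false by lia.
    by have -> : (m == n) = false by [lia]; rewrite !addn0.
  have [->|h'] := eqVneq m n; first by have -> : (n == n.-1) = false by lia.
  by have -> : (m == n.-1) = true by [lia]; rewrite addn0.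
have cN : #|nontriv| = #|P| + #|Q| + #|S| by rewrite -!sum1_card split3.
rewrite /enough cN; apply: loose_arith => //.
- rewrite mulnC -sum_nat_const; apply: leq_sum => v _; by rewrite addn1; apply: loose.
- rewrite sum_ndeg split3; apply: leq_add; [apply: leq_add|].
  + rewrite mulnC -sum_nat_const; apply: leq_sum => C; rewrite in_set => /andP [CN _].
    by have := nontriv_arcs CN; move: CN; rewrite in_set; lia.
  + rewrite mulnC -sum_nat_const; apply: leq_sum => C; rewrite in_set => /andP [CN /eqP m].
    by have := nontriv_arcs CN; rewrite m; lia.
  + rewrite mulnC -sum_nat_const; apply: leq_sum => C; rewrite in_set => sC.
    by have := spanning_arcs sC; lia.
have main := waste_main; rewrite /t -/S in main.
(* On [m] vertices the waste is at least [2 * (m - 1) * (n - m)], which is at least [4 * (n - 3)]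
   for [3 <= m <= n - 2]. *)
have lowN : 4 * (n - 3) * #|P| + 2 * (n - 2) * #|Q| <=
    \sum_(C in nontriv) arcs C * (n - #|supp C|).
  rewrite split3; apply: leq_trans (leq_addr _ _); apply: leq_add.
    rewrite mulnC -sum_nat_const; apply: leq_sum => C; rewrite in_set => /andP [CN mC].
    have := nontriv_arcs CN; move: CN; rewrite in_set.
    have [a ea] : exists a, #|supp C| = a by exists #|supp C|.
    rewrite ea in mC *; move: (arcs C) => x m2 xm.
    have [b eb] : exists b, a = b + 3 by exists (a - 3); lia.
    have [c ec] : exists c, n = b + c + 5 by exists (n - b - 5); lia.
    rewrite ec eb in xm mC *.
    have -> : b + c + 5 - (b + 3) = c + 2 by lia.
    have -> : b + c + 5 - 3 = b + c + 2 by lia.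
    have : (2 * b + 4) * (c + 2) <= x * (c + 2) by rewrite leq_mul2r; lia.
    by nia.
  rewrite mulnC -sum_nat_const; apply: leq_sum => C; rewrite in_set => /andP [CN /eqP mC].
  have := nontriv_arcs CN; rewrite mC.
  have -> : n - n.-1 = 1 by lia.
  by lia.
(* Trivial colours miss at least [n - 2] vertices; their waste cancels their share of the total,
   leaving only [SD] on the right. *)
have lowT : (n - 2) * \sum_(C | C \notin nontriv) arcs C <=
    \sum_(C | C \notin nontriv) arcs C * (n - #|supp C|).
  rewrite big_distrr /=; apply: leq_sum => C; rewrite in_set -leqNgt => m2.
  by rewrite mulnC leq_mul2l; lia.
have tot := sum_triv_arcs; move: main.
rewrite (bigID (mem nontriv)) /= -tot; move: lowN lowT tot.
move: (\sum_(C in nontriv) _) (\sum_(C | C \notin nontriv) arcs C * _) => XN XT.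
move: (\sum_(C | _) arcs C) (\sum_v ndeg v) => TA SD lowN lowT tot main.
have e1 : (SD + TA) * (2 * (n - 2)) = 2 * (n - 2) * SD + 2 * ((n - 2) * TA).
  by rewrite mulnC mulnDr mulnA.
have e2 : (SD + TA) * (2 * k.-1) = 2 * (n * n.-1) * k.-1 by rewrite tot mulnCA mulnA.
rewrite e1 e2 in main.
have e3 : 8 * (n - 3) * #|P| = 2 * (4 * (n - 3) * #|P|) by rewrite !mulnA.
have e4 : 4 * (n - 2) * #|Q| = 2 * (2 * (n - 2) * #|Q|) by rewrite !mulnA.
by rewrite e3 e4; lia.
Qed.

Lemma colours_bound_small : 2 <= k <= 5 -> 2 * #|colours| + k * n <= n * n.-1 + 2.
Proof.
case/andP => _ k5; have [k3|] := leqP 3 k; last first.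
  by move=> k3; have ek : k = 2 by [lia]; rewrite ek; apply: colours_bound2.
apply: colours_of_ndeg; rewrite -/enough.
have kk : 3 <= k <= 5 by rewrite k3.
have [/existsP [v /eqP tv]|] := boolP [exists v, ndeg v == k]; first exact: tight_enough tv.
rewrite negb_exists => /forallP h; apply: loose_enough => // v.
by rewrite ltn_neqAle eq_sym h ndeg_ge.
Qed.

End Degrees.

(** * The bounds *)

Lemma bin2_double n : 2 * 'C(n, 2) = n * n.-1.
Proof.
rewrite bin2 mul2n -[RHS]odd_double_half oddM.
by case: n => // n; rewrite /= andNb.
Qed.

Lemma exists_max (P : nat -> Prop) B m0 : P m0 -> (forall m, P m -> m <= B) ->
  exists2 m, P m & forall m', P m' -> m' <= m.
Proof.
elim: B => [|B IH] Pm0 le.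
  by exists m0 => // m /le; rewrite leqn0 => /eqP ->.
have [PB|nPB] := classic (P B.+1); first by exists B.+1.
apply: IH => // m Pm; have := le _ Pm; rewrite leq_eqVlt => /orP [/eqP e|//].
by case: nPB; rewrite -e.
Qed.

Section UpperBounds.
Variables (n k : nat) (c : 'I_n -> 'I_n -> nat).
Hypotheses (k_ge2 : 2 <= k) (k_lt_n : k < n).
Hypotheses (c_sym : edge_colouring c) (c_conn : mono_k_connected k c).

Lemma ncolours_upper : ncolours c <=
  'C(n, 2) - ((k - 1) * n * (n - 1) + 2 * (n - 2) - 1) %/ (2 * (n - 2)) + 1.
Proof.
have kn : k < #|'I_n| by rewrite card_ord.
have := colours_bound (component_sym c_sym) (component_connected c_sym)
  (component_long_connected c_sym c_conn) k_ge2 kn.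
have := component_ncolours c; rewrite card_ord.
move: (ncolours c) #|_| => t T tT.
have e2 := bin2_double n.
have -> : (k - 1) * n * (n - 1) = 2 * 'C(n, 2) * k.-1 by rewrite !subn1 e2 -mulnA mulnC.
have -> : n * n.-1 * (n - 2) = 'C(n, 2) * (2 * (n - 2)) by rewrite -e2 -mulnA mulnCA.
rewrite -e2.
move: 'C(n, 2) => C; set d := 2 * (n - 2); set x := 2 * C * _.
have d0 : 0 < d by rewrite /d; lia.
move=> h; have {}h : d * t.-1 + x <= C * d.
  by apply: leq_trans h; rewrite leq_add2r leq_mul2l; apply/orP; right; lia.
(* Makes the truncated subtraction in the bound exact. *)
have tC : t.-1 <= C.
  by rewrite -(leq_pmul2l d0) [d * C]mulnC; apply: leq_trans h; apply: leq_addr.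
have : (x + d - 1) %/ d < (C - t.-1).+1.
  rewrite ltn_divLR // mulSn mulnBl [t.-1 * d]mulnC; lia.
by move: (_ %/ _) => M; lia.
Qed.

Lemma ncolours_upper_small : k <= 5 -> ncolours c <= 'C(n, 2) - (k * n + 1) %/ 2 + 1.
Proof.
move=> k5; have kn : k < #|'I_n| by rewrite card_ord.
have kk : 2 <= k <= 5 by rewrite k_ge2.
have := colours_bound_small (component_sym c_sym) (component_connected c_sym)
  (component_long_connected c_sym c_conn) k_ge2 kn kk.
have := component_ncolours c; rewrite card_ord -bin2_double.
move: (ncolours c) #|_| (k * n) => t T x; move: 'C(n, 2) => C; lia.
Qed.
End UpperBounds.

Theorem theorem4p2 :
  (forall n k : nat, 2 <= k -> k < n ->
     exists m, is_mc_complete k n m /\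
       'C(n, 2) - (k * n + 1) %/ 2 + 1 <= m /\
       m <= 'C(n, 2)
            - ((k - 1) * n * (n - 1) + 2 * (n - 2) - 1) %/ (2 * (n - 2)) + 1) /\
  (forall n k : nat, 2 <= k <= 5 -> k < n ->
     is_mc_complete k n ('C(n, 2) - (k * n + 1) %/ 2 + 1)).
Proof.
split=> n k.
  move=> k2 kn.
  pose P m := exists c : 'I_n -> 'I_n -> nat,
    edge_colouring c /\ mono_k_connected k c /\ ncolours c = m.
  have P0 : P (ncolours (@harary_colouring n k)).
    exists (@harary_colouring n k); split; first exact: harary_colouring_sym.
    by split=> //; apply: harary_colouring_connected.
  have le m : P m -> m <= 'C(n, 2) -
      ((k - 1) * n * (n - 1) + 2 * (n - 2) - 1) %/ (2 * (n - 2)) + 1.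
    by case=> c [cs [cc <-]]; apply: ncolours_upper.
  have [m Pm max] := exists_max P0 le; exists m; split.
    by split=> // c cs cc; apply: max; exists c.
  by split; [apply: leq_trans (max _ P0); apply: harary_ncolours | apply: le].
case/andP => k2 k5 kn; split; last by move=> c cs cc; apply: ncolours_upper_small cc _.
exists (@harary_colouring n k); split; first exact: harary_colouring_sym.
have cc := harary_colouring_connected k2 kn; split=> //.
apply/eqP; rewrite eqn_leq harary_ncolours // andbT.
by apply: ncolours_upper_small => //; apply: harary_colouring_sym.
Qed.
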